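(* Fix $(x,t)\in\mathbb{R}\times[0,\infty)$, and let $\gamma$, $\lambda_1,\dots,\lambda_N\in\mathbb{C}^+$, $m_1,\dots,m_N$ and $f$ be the scattering data described in the context. For $k=1,\dots,N$ let $D_k\subset\mathbb{C}^+$ be a small disk centred at $\lambda_k$ and $\hat D_k=\{\lambda\in\mathbb{C}^-:\bar\lambda\in D_k\}$, with radii so small that all these disks are pairwise disjoint and disjoint from $\mathbb{R}$. Let $\Sigma=\mathbb{R}\cup\bigcup_{k=1}^N(\partial D_k\cup\partial\hat D_k)$, where $\mathbb{R}$ is oriented from left to right, each $\partial D_k$ clockwise and each $\partial\hat D_k$ counterclockwise. Suppose that the $2\times2$ matrix-valued function $\hat{\mathbf M}(x,t;\lambda)$ satisfies: (1) $\hat{\mathbf M}(x,t;\lambda)$ is analytic in $\lambda\in\mathbb{C}\setminus\Sigma$; (2) $\hat{\mathbf M}$ takes continuous boundary values $\hat{\mathbf M}_+$ (from the left) and $\hat{\mathbf M}_-$ (from the right) on $\Sigma$, and $\hat{\mathbf M}_+(x,t;\lambda)=\hat{\mathbf M}_-(x,t;\lambda)\hat{\mathbf J}(x,t;\lambda)$ for $\lambda\in\Sigma$, where $$\hat{\mathbf J}=\begin{pmatrix}1&\gamma(\lambda)e^{2i\Theta}\\ \lambda\overline{\gamma(\lambda)}e^{-2i\Theta}&1+\lambda|\gamma(\lambda)|^2\end{pmatrix}\ (\lambda\in\mathbb{R}),$$ $$\hat{\mathbf J}=\begin{pmatrix}1&\frac{f(\lambda)e^{2i\Theta}}{(\lambda-\lambda_k)^{m_k+1}}\\0&1\end{pmatrix}\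 (\lambda\in\partial D_k),\qquad \hat{\mathbf J}=\begin{pmatrix}1&0\\ \frac{\lambda\overline{f(\bar\lambda)}e^{-2i\Theta}}{(\lambda-\bar\lambda_k)^{m_k+1}}&1\end{pmatrix}\ (\lambda\in\partial\hat D_k),$$ with $\Theta=\Theta(x,t;\lambda)=\frac14(\lambda-\lambda^{-1})x+\frac14(\lambda+\lambda^{-1})t$; (3) $\hat{\mathbf M}(x,t;\lambda)=O(\lambda^{-1})$ as $\lambda\to\infty$. Then $\hat{\mathbf M}(x,t;\lambda)\equiv\mathbf 0$.
   Context: $\mathbb{C}^{\pm}$ denote the open upper/lower half-planes and $\sigma_3=\mathrm{diag}(1,-1)$. The massive Thirring model (MTM) is the system $i(u_t+u_x)+v+|v|^2u=0$, $i(v_t-v_x)+u+|u|^2v=0$ for complex-valued $u(x,t),v(x,t)$, $x\in\mathbb{R}$, $t\ge0$. Standing assumptions: $(u,v)$ is a solution decaying, with its $x$-derivatives, as $|x|\to\infty$, and for each $t$, $u,v\in L^1(\mathbb{R})\cap L^\infty(\mathbb{R})$, $u_x,v_x\in L^1(\mathbb{R})$. Jost functions: let $$\mathbf Q_1=\begin{pmatrix}\frac i4(|u|^2+|v|^2)&-\frac i2\bar v\\ v_x+\frac i2|u|^2v+\frac i2u&-\frac i4(|u|^2+|v|^2)\end{pmatrix},\qquad \mathbf Q_2=-\frac i2\begin{pmatrix}\bar uv&-\bar u\\ v+\bar uv^2&-\bar uv\end{pmatrix},$$ and let $\Phi_\pm=(\Phi_{\pm1},\Phi_{\pm2})$ (columns)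 be the solutions of $$\Phi_\pm(x,t;\lambda)=\mathbf I+\int_{\pm\infty}^x e^{\frac i4(\lambda-\lambda^{-1})(x-y)\sigma_3}(\mathbf Q_1+\lambda^{-1}\mathbf Q_2)\Phi_\pm(y,t;\lambda)e^{-\frac i4(\lambda-\lambda^{-1})(x-y)\sigma_3}\,dy .$$ They are defined for $\lambda\in\mathbb{R}\setminus\{0\}$; $\Phi_{+1},\Phi_{-2}$ extend analytically to $\lambda\in\mathbb{C}^+$ and $\Phi_{-1},\Phi_{+2}$ to $\lambda\in\mathbb{C}^-$. Scattering data: with $\Theta=\frac14(\lambda-\lambda^{-1})x+\frac14(\lambda+\lambda^{-1})t$, the scattering matrix (independent of $x,t$) is defined by $\Phi_-=\Phi_+e^{i\Theta\sigma_3}\mathbf S(\lambda)e^{-i\Theta\sigma_3}$, $\lambda\in\mathbb{R}\setminus\{0\}$, and has the form $\mathbf S=\begin{pmatrix}\overline{\alpha(\bar\lambda)}&\beta(\lambda)\\-\lambda\overline{\beta(\bar\lambda)}&\alpha(\lambda)\end{pmatrix}$; $\alpha(\lambda)=\det(\Phi_{+1},\Phi_{-2})$ extends analytically to $\mathbb{C}^+$. The reflection coefficient is $\gamma=\beta/\alpha$ on $\mathbb{R}\setminus\{0\}$; it tends to $0$ as $\lambda\to0$ and $\lambda\to\infty$ (so $\gamma(0):=0$ and $\hat{\mathbf J}=\mathbf I$ at $\lambda=0$). It is assumed that $\alpha$ has exactly $N$ distinct zeros $\lambda_1,\dots,\lambda_N\in\mathbb{C}^+$, of multiplicities $m_1+1,\dots,m_N+1$,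 and no zeros on the real axis. $f$ is the unique polynomial of degree less than $\sum_k(m_k+1)$, with $f(\lambda_k)\ne0$, such that for all $k$ and $0\le n_k\le m_k$ $$\operatorname*{Res}_{\lambda=\lambda_k}\frac{(\lambda-\lambda_k)^{n_k}\Phi_{-2}}{\alpha(\lambda)}=\frac{\partial_\lambda^{m_k-n_k}[f e^{2i\Theta}\Phi_{+1}]|_{\lambda=\lambda_k}}{(m_k-n_k)!},\quad \operatorname*{Res}_{\lambda=\bar\lambda_k}\frac{(\lambda-\bar\lambda_k)^{n_k}\Phi_{-1}}{\overline{\alpha(\bar\lambda)}}=-\frac{\partial_\lambda^{m_k-n_k}[\lambda\overline{f(\bar\lambda)}e^{-2i\Theta}\Phi_{+2}]|_{\lambda=\bar\lambda_k}}{(m_k-n_k)!}.$$ *)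

(* Defs.v *)
From HB Require Import structures.
From mathcomp Require Import all_boot all_order all_algebra complex.
From mathcomp Require Import all_classical all_reals all_analysis.

Set Implicit Arguments.
Unset Strict Implicit.
Unset Printing Implicit Defensive.

Import Order.TTheory GRing.Theory Num.Theory.
Import numFieldNormedType.Exports.

Local Open Scope classical_set_scope.
Local Open Scope ring_scope.
Local Open Scope complex_scope.

(* MathComp-Analysis puts the topology of the modulus on R[i]^o; this copies it
   to R[i] itself.  Derivatives of functions on R[i] are then complex
   derivatives, and matrices over R[i] carry the entrywise topology. *)
HB.instance Definition _ (R : realType) := NormedModule.copy R[i] R[i]^o.

Section Defs.
Variable R : realType.
Notation C := R[i].
Notation Re := (@complex.Re R).
Notation Im := (@complex.Im R).
Notation mu := (@lebesgue_measure R).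

Definition upper : set C := [set z | 0 < Im z].
Definition lower : set C := [set z | Im z < 0].
Definition realline : set C := [set z | Im z = 0].
Definition open_disk (c : C) (r : R) : set C := [set z | `|z - c| < r%:C].
Definition closed_disk (c : C) (r : R) : set C := [set z | `|z - c| <= r%:C].
Definition circle (c : C) (r : R) : set C := [set z | `|z - c| = r%:C].

Definition cexp (z : C) : C := (expR (Re z))%:C * (cos (Im z) +i* sin (Im z)).

Definition mx2 (a b c d : C) : 'M[C]_2 :=
  \matrix_(i, j) if i == 0 then (if j == 0 then a else b)
                 else (if j == 0 then c else d).

(* e^{z sigma_3} *)
Definition exp_sigma3 (z : C) : 'M[C]_2 := mx2 (cexp z) 0 0 (cexp (- z)).

Definition holomorphic_on (V : normedModType C) (U : set C) (g : C -> V) :=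
  forall z, U z -> derivable g z 1.

Definition cintegrable (D : set R) (g : R -> C) : Prop :=
  mu.-integrable D (EFin \o (Re \o g)) /\ mu.-integrable D (EFin \o (Im \o g)).

Definition cintegral (D : set R) (g : R -> C) : C :=
  Rintegral mu D (Re \o g) +i* Rintegral mu D (Im \o g).

Definition mxintegrable (p q : nat) (D : set R) (F : R -> 'M[C]_(p, q)) :=
  forall i j, cintegrable D (fun y => F y i j).

Definition mxintegral (p q : nat) (D : set R) (F : R -> 'M[C]_(p, q))
    : 'M[C]_(p, q) :=
  \matrix_(i, j) cintegral D (fun y => F y i j).

(* (2 pi i)^{-1} times the integral of g over the positive circle |z - a| = r *)
Definition circle_mean (g : C -> C) (a : C) (r : R) : C :=
  cintegral `[0, 2 * pi]
    (fun th => let w := r%:C * (cos th +i* sin th) in g (a + w) * w)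
  / (2 * pi)%:C.

Definition is_residue (g : C -> C) (a c : C) : Prop :=
  \forall r \near 0^'+, circle_mean g a r = c.

Definition has_zero_of_order (g : C -> C) (a : C) (n : nat) : Prop :=
  (forall j, (j < n)%N -> derive1n j g a = 0) /\ derive1n n g a <> 0.

(* Derivative of a complex function of a real variable along a set D of
   parameters: one-sided at an endpoint of D. *)
Definition diff_quot (g : R -> C) (s : R) : R -> C :=
  fun s' => (g s' - g s) / (s' - s)%:C.
Definition rderivable (D : set R) (g : R -> C) (s : R) : Prop :=
  cvg (diff_quot g s @ within D s^').
Definition rderive (D : set R) (g : R -> C) (s : R) : C :=
  lim (diff_quot g s @ within D s^').

Definition dx (w : R -> R -> C) (x t : R) : C :=
  rderive [set: R] (fun x' => w x' t) x.
Definition dt (w : R -> R -> C) (x t : R) : C :=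
  rderive [set s | 0 <= s] (w x) t.

Definition decaying (g : R -> C) : Prop :=
  g y @[y --> +oo] --> (0 : C) /\ g y @[y --> -oo] --> (0 : C).

Definition in_L1 (g : R -> C) : Prop := cintegrable [set: R] g.

Definition in_Linfty (g : R -> C) : Prop :=
  measurable_fun [set: R] (Re \o g) /\ measurable_fun [set: R] (Im \o g) /\
  exists K : R, {ae mu, forall y, `|g y| <= K%:C}.

Record mtm_solution (u v : R -> R -> C) : Prop := MTMSolution {
  mtm_dx : forall x t : R, 0 <= t ->
    rderivable [set: R] (fun x' => u x' t) x /\
    rderivable [set: R] (fun x' => v x' t) x;
  mtm_dt : forall x t : R, 0 <= t ->
    rderivable [set s | 0 <= s] (u x) t /\
    rderivable [set s | 0 <= s] (v x) t;
  mtm_eq1 : forall x t : R, 0 <= t ->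
    'i * (dt u x t + dx u x t) + v x t + `|v x t| ^+ 2 * u x t = 0;
  mtm_eq2 : forall x t : R, 0 <= t ->
    'i * (dt v x t - dx v x t) + u x t + `|u x t| ^+ 2 * v x t = 0;
  mtm_decay : forall t : R, 0 <= t ->
    [/\ decaying (fun x => u x t), decaying (fun x => v x t),
        decaying (fun x => dx u x t) & decaying (fun x => dx v x t)];
  mtm_L1 : forall t : R, 0 <= t ->
    [/\ in_L1 (fun x => u x t), in_L1 (fun x => v x t),
        in_L1 (fun x => dx u x t) & in_L1 (fun x => dx v x t)];
  mtm_Linfty : forall t : R, 0 <= t ->
    in_Linfty (fun x => u x t) /\ in_Linfty (fun x => v x t)
}.

Definition Q1 (u v : R -> R -> C) (x t : R) : 'M[C]_2 :=
  let U := u x t in let V := v x t in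
  mx2 ('i / 4 * (`|U| ^+ 2 + `|V| ^+ 2))
      (- ('i / 2 * V^*))
      (dx v x t + 'i / 2 * `|U| ^+ 2 * V + 'i / 2 * U)
      (- ('i / 4 * (`|U| ^+ 2 + `|V| ^+ 2))).

Definition Q2 (u v : R -> R -> C) (x t : R) : 'M[C]_2 :=
  let U := u x t in let V := v x t in
  (- ('i / 2)) *: mx2 (U^* * V)             (- U^*)
                      (V + U^* * V ^+ 2)    (- (U^* * V)).

Definition Theta (x t : R) (z : C) : C :=
  (z - z^-1) / 4 * x%:C + (z + z^-1) / 4 * t%:C.

Definition jost_integrand (u v : R -> R -> C) (Phi : R -> 'M[C]_2)
    (t : R) (z : C) (x y : R) : 'M[C]_2 :=
  let w := 'i / 4 * (z - z^-1) * (x - y)%:C in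
  exp_sigma3 w *m (Q1 u v y t + z^-1 *: Q2 u v y t) *m Phi y
    *m exp_sigma3 (- w).

Definition mx_of_cols (c1 c2 : 'cV[C]_2) : 'M[C]_2 := row_mx c1 c2.

Definition extends_to (U : set C) (g : C -> 'cV[C]_2) : Prop :=
  holomorphic_on U g /\
  {within (U `|` realline) `\ 0, continuous g}.

(* The four columns are kept apart because off the real line only one column
   of each of Phi_+ and Phi_- exists; the value of each column is only
   meaningful on R \ {0} and on its half-plane of analyticity.  The integral
   from +oo to x is minus the integral over [x, +oo[. *)
Record jost_functions (u v : R -> R -> C)
    (Phip1 Phip2 Phim1 Phim2 : R -> R -> C -> 'cV[C]_2) : Prop := JostFunctions {
  jost_plus : forall (t l : R), 0 <= t -> l <> 0 ->
    let Phi y := mx_of_cols (Phip1 y t l%:C) (Phip2 y t l%:C) in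
    forall x,
      mxintegrable `[x, +oo[ (jost_integrand u v Phi t l%:C x) /\
      Phi x = 1%:M - mxintegral `[x, +oo[ (jost_integrand u v Phi t l%:C x);
  jost_minus : forall (t l : R), 0 <= t -> l <> 0 ->
    let Phi y := mx_of_cols (Phim1 y t l%:C) (Phim2 y t l%:C) in
    forall x,
      mxintegrable `]-oo, x] (jost_integrand u v Phi t l%:C x) /\
      Phi x = 1%:M + mxintegral `]-oo, x] (jost_integrand u v Phi t l%:C x);
  jost_upper : forall x t : R, 0 <= t ->
    extends_to upper (Phip1 x t) /\ extends_to upper (Phim2 x t);
  jost_lower : forall x t : R, 0 <= t ->
    extends_to lower (Phim1 x t) /\ extends_to lower (Phip2 x t)
}.

Definition scattering_matrix (alpha : C -> C) (beta : R -> C) (l : R)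
    : 'M[C]_2 :=
  mx2 (alpha l%:C)^*            (beta l)
      (- (l%:C * (beta l)^*))   (alpha l%:C).

Definition reflection (alpha : C -> C) (beta : R -> C) (l : R) : C :=
  if l == 0 then 0 else beta l / alpha l%:C.

Record scattering_data (Phip1 Phip2 Phim1 Phim2 : R -> R -> C -> 'cV[C]_2)
    (alpha : C -> C) (beta : R -> C) : Prop := ScatteringData {
  scat_matrix : forall x t l : R, 0 <= t -> l <> 0 ->
    mx_of_cols (Phim1 x t l%:C) (Phim2 x t l%:C) =
    mx_of_cols (Phip1 x t l%:C) (Phip2 x t l%:C)
      *m exp_sigma3 ('i * Theta x t l%:C)
      *m scattering_matrix alpha beta l
      *m exp_sigma3 (- ('i * Theta x t l%:C));
  scat_alpha : forall (x t : R) (z : C),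
    0 <= t -> (upper `|` realline) z -> z <> 0 ->
    alpha z = \det (mx_of_cols (Phip1 x t z) (Phim2 x t z));
  scat_refl0 : reflection alpha beta l @[l --> 0^'] --> (0 : C);
  scat_refl_infty : decaying (reflection alpha beta)
}.

Record discrete_data (Phip1 Phip2 Phim1 Phim2 : R -> R -> C -> 'cV[C]_2)
    (alpha : C -> C) (N : nat) (lam : 'I_N -> C) (m : 'I_N -> nat)
    (f : {poly C}) : Prop := DiscreteData {
  disc_inj : injective lam;
  disc_upper : forall k, upper (lam k);
  disc_zeros : forall z, upper z -> alpha z = 0 -> exists k, z = lam k;
  disc_order : forall k, has_zero_of_order alpha (lam k) (m k).+1;
  disc_real : forall l : R, l <> 0 -> alpha l%:C <> 0;
  disc_deg : (size f <= \sum_(k < N) (m k).+1)%N;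
  disc_neq0 : forall k, f.[lam k] <> 0;
  disc_res_upper : forall x t : R, 0 <= t -> forall k n, (n <= m k)%N ->
    forall i : 'I_2,
    is_residue (fun z : C => (z - lam k) ^+ n * Phim2 x t z i 0 / alpha z)
      (lam k)
      (derive1n (m k - n)
         (fun z : C => f.[z] * cexp (2 * 'i * Theta x t z) * Phip1 x t z i 0)
         (lam k) / ((m k - n)`!)%:R);
  disc_res_lower : forall x t : R, 0 <= t -> forall k n, (n <= m k)%N ->
    forall i : 'I_2,
    is_residue (fun z : C => (z - (lam k)^*) ^+ n * Phim1 x t z i 0
                           / (alpha z^*)^*)
      (lam k)^*
      (- (derive1n (m k - n)
            (fun z : C => z * (f.[z^*])^* * cexp (- (2 * 'i * Theta x t z))
                        * Phip2 x t z i 0)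
            (lam k)^* / ((m k - n)`!)%:R))
}.

Definition jump_real (g : R -> C) (x t : R) (z : C) : 'M[C]_2 :=
  mx2 1
      (g (Re z) * cexp (2 * 'i * Theta x t z))
      (z * (g (Re z))^* * cexp (- (2 * 'i * Theta x t z)))
      (1 + z * `|g (Re z)| ^+ 2).

Definition jump_disk (f : {poly C}) (a : C) (n : nat) (x t : R) (z : C)
    : 'M[C]_2 :=
  mx2 1 (f.[z] * cexp (2 * 'i * Theta x t z) / (z - a) ^+ n.+1)
      0 1.

Definition jump_disk_hat (f : {poly C}) (a : C) (n : nat) (x t : R) (z : C)
    : 'M[C]_2 :=
  mx2 1 0
      (z * (f.[z^*])^* * cexp (- (2 * 'i * Theta x t z)) / (z - a^*) ^+ n.+1)
      1.

(* "These disks are disjoint" is read for the closed disks, so that the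
   components of the contour do not touch.  The reflected disks are then
   automatically disjoint from each other, from the real line and from the
   disks in the upper half-plane. *)
Definition admissible_radii (N : nat) (lam : 'I_N -> C) (rho : 'I_N -> R) :=
  [/\ forall k, 0 < rho k,
      forall k, closed_disk (lam k) (rho k) `<=` upper &
      forall j k, j <> k ->
        closed_disk (lam j) (rho j) `&` closed_disk (lam k) (rho k) = set0].

Definition contour (N : nat) (lam : 'I_N -> C) (rho : 'I_N -> R) : set C :=
  realline `|`
  \bigcup_(k in [set: 'I_N])
    (circle (lam k) (rho k) `|` circle (lam k)^* (rho k)).

(* On the curve, M has the boundary value Mp from the side L and Mm from the
   side S, related by the jump matrix J. *)
Definition boundary_jump (M Mp Mm : C -> 'M[C]_2) (curve L S : set C)
    (J : C -> 'M[C]_2) : Prop :=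
  forall z, curve z ->
    [/\ M w @[w --> within L (nbhs z)] --> Mp z,
        M w @[w --> within S (nbhs z)] --> Mm z &
        Mp z = Mm z *m J z].

(* The left side comes first: it is the upper half-plane for the real line
   oriented from left to right, the exterior of the disk for a clockwise
   circle and the interior for a counterclockwise one. *)
Record RH_problem (g : R -> C) (N : nat) (lam : 'I_N -> C) (m : 'I_N -> nat)
    (f : {poly C}) (rho : 'I_N -> R) (x t : R) (M Mp Mm : C -> 'M[C]_2)
    : Prop := RHProblem {
  rh_analytic : holomorphic_on (~` contour lam rho) M;
  rh_continuous : {within contour lam rho, continuous Mp} /\
                  {within contour lam rho, continuous Mm};
  rh_real : boundary_jump M Mp Mm realline upper lower (jump_real g x t);
  rh_disk : forall k,
    boundary_jump M Mp Mm (circle (lam k) (rho k))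
      (~` closed_disk (lam k) (rho k)) (open_disk (lam k) (rho k))
      (jump_disk f (lam k) (m k) x t);
  rh_disk_hat : forall k,
    boundary_jump M Mp Mm (circle (lam k)^* (rho k))
      (open_disk (lam k)^* (rho k)) (~` closed_disk (lam k)^* (rho k))
      (jump_disk_hat f (lam k) (m k) x t);
  rh_decay : exists K r : R, forall z, ~ contour lam rho z -> r%:C <= `|z| ->
    forall i j, `|M z i j| <= K%:C / `|z|
}.

End Defs.

(* Main.v *)
(* With d(z) = diag(1, z), the function M(z) d(z) M(conj z)^dagger has no jump
   across the contour, because J(z) d(z) = d(z) J(conj z)^dagger for each pair of
   conjugate jump matrices.  It is therefore continuous on the whole plane,
   holomorphic off lines and circles, which are removable, and it is O(1/z); so it
   vanishes.  At a point of the positive half-line this reads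
   M_- (J d) M_-^dagger = 0 with J d positive definite, hence M_- = M_+ = 0 there.
   On each half-plane one column of M has no jump across the circles, so it
   vanishes by unique continuation, after which the other column has no jump
   either and vanishes too. *)

Require Import Defs.
From HB Require Import structures.
From mathcomp Require Import all_boot all_order all_algebra complex.
From mathcomp Require Import all_classical all_reals all_analysis.
From mathcomp Require Import ring lra.
Import Order.TTheory GRing.Theory Num.Theory.
Import Normc.
Import numFieldNormedType.Exports.
Local Open Scope classical_set_scope.
Local Open Scope ring_scope.
Local Open Scope complex_scope.

Set Implicit Arguments.
Unset Strict Implicit.

(** * Complex numbers and continuity *)

Section ComplexBasics.
Variable R : realType.
Notation C := R[i].
Notation Re := (@complex.Re R).
Notation Im := (@complex.Im R).
Notation cj := (@conjc R).
Implicit Types (z w : C) (a b e : R).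

(** At a real point $z$ the form $J d$ is a square plus $z|b|^2$, so it is definite for $z>0$ only.
    Vanishing boundary values are therefore available on a half-line, and unique continuation has to
    fill both half-planes from there. The origin is no exception: the symmetry of the jumps is a
    pointwise algebraic identity, valid there too, with $0^{-1}=0$.

    No power series and no Cauchy formula enter. A function that is continuous, and differentiable
    off one line or circle, is handled through antiderivatives: its integrals over small rectangles
    vanish, so it has a local primitive. The substitution $w=z_0+e^v$ turns this into the mean value
    property, hence the maximum principle. Both global conclusions come from the latter: vanishing
    at infinity forces zero (large disks), and zeros propagate (quotients by powers of $z-a$).
    Differentiability at the points of the curves is never established. *)

Lemma normr_normcE z : `|z| = (normc z)%:C. Proof. by []. Qed.

Lemma normc_ge0 z : 0 <= normc z.
Proof. by case: z => a b; rewrite /= sqrtr_ge0. Qed.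

Lemma normc_eq0 z : (normc z == 0) = (z == 0).
Proof. by apply/eqP/eqP => [/eq0_normc//|->]; rewrite normc0. Qed.

Lemma normc_gt0 z : (0 < normc z) = (z != 0).
Proof. by rewrite lt_def normc_ge0 andbT normc_eq0. Qed.

Lemma normc_triangle z w : normc (z + w) <= normc z + normc w.
Proof. exact: le_normcD. Qed.

Lemma normc_distC z w : normc (z - w) = normc (w - z).
Proof. by rewrite -normcN opprB. Qed.

Lemma normc_triangleB z w : normc (z - w) <= normc z + normc w.
Proof. by rewrite -(normcN w) normc_triangle. Qed.

Lemma normc_sub_ge z w : normc z - normc w <= normc (z - w).
Proof. by rewrite lerBlDr -{1}(subrK w z) normc_triangle. Qed.

Lemma normc_sqr z : normc z ^+ 2 = Re z ^+ 2 + Im z ^+ 2.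
Proof. by case: z => a b /=; rewrite sqr_sqrtr// addr_ge0// sqr_ge0. Qed.

Lemma normc_Re z : `|Re z| <= normc z.
Proof.
by rewrite -(ler_pXn2r (n:=2))// ?nnegrE ?normc_ge0// normc_sqr real_normK ?num_real// lerDl sqr_ge0.
Qed.

Lemma normc_Im z : `|Im z| <= normc z.
Proof.
by rewrite -(ler_pXn2r (n:=2))// ?nnegrE ?normc_ge0// normc_sqr real_normK ?num_real// lerDr sqr_ge0.
Qed.

Lemma normc_le_ReIm z : normc z <= `|Re z| + `|Im z|.
Proof.
rewrite -(ler_pXn2r (n:=2))// ?nnegrE ?normc_ge0 ?addr_ge0// normc_sqr sqrrD.
rewrite !real_normK ?num_real// lerD2r lerDl mulrn_wge0// mulr_ge0//.
Qed.

Lemma normc_real a : normc a%:C = `|a|.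
Proof. by rewrite /= expr0n/= addr0 sqrtr_sqr. Qed.

Lemma normc_conj z : normc (cj z) = normc z.
Proof. by case: z => a b /=; rewrite sqrrN. Qed.

Lemma normcX z n : normc (z ^+ n) = normc z ^+ n.
Proof. by elim: n => [|n ih]; rewrite ?expr0 ?normc1// !exprS normcM ih. Qed.

Lemma ReD z w : Re (z + w) = Re z + Re w. Proof. by case: z; case: w. Qed.
Lemma ImD z w : Im (z + w) = Im z + Im w. Proof. by case: z; case: w. Qed.
Lemma ReN z : Re (- z) = - Re z. Proof. by case: z. Qed.
Lemma ImN z : Im (- z) = - Im z. Proof. by case: z. Qed.
Lemma ReM z w : Re (z * w) = Re z * Re w - Im z * Im w.
Proof. by case: z; case: w. Qed.
Lemma ImM z w : Im (z * w) = Re z * Im w + Im z * Re w.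
Proof. by case: z; case: w. Qed.
Lemma ReJ z : Re (cj z) = Re z. Proof. by case: z. Qed.
Lemma ImJ z : Im (cj z) = - Im z. Proof. by case: z. Qed.
Lemma conjcM z w : cj (z * w) = cj z * cj w. Proof. exact: rmorphM. Qed.
Lemma conjcD z w : cj (z + w) = cj z + cj w. Proof. exact: rmorphD. Qed.
Lemma conjcB z w : cj (z - w) = cj z - cj w. Proof. exact: rmorphB. Qed.

Lemma eq_ReIm z w : Re z = Re w -> Im z = Im w -> z = w.
Proof. by case: z => a b; case: w => c d /= -> ->. Qed.

(** The norm of [R[i]] takes its values in [R[i]], so balls have complex radii. A positive element
    of [R[i]] is real, which gives back real radii and the usual epsilon-delta form. *)
Lemma nbhsCP z (P : set C) :
  nbhs z P <-> exists2 d : R, 0 < d & forall w, normc (w - z) < d -> P w.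
Proof.
split.
- move=> /nbhs_normP [d /= d0 H]; exists (Re d).
    by move: d0; rewrite ltcE => /andP[].
  move=> w hw; apply: H => /=; rewrite -normrN opprB.
  have dE : d = (Re d)%:C.
    by case: (d) d0 => p q; rewrite ltcE /= => /andP[/eqP -> _].
  by rewrite dE normr_normcE ltcR.
- move=> [d d0 H]; apply/nbhs_normP; exists d%:C; first by rewrite /= ltcR.
  by move=> w /=; rewrite -normrN opprB normr_normcE ltcR => /H.
Qed.

Lemma contCP (f : C -> C) z : {for z, continuous f} <->
  forall e, 0 < e -> exists2 d : R, 0 < d &
    forall w, normc (w - z) < d -> normc (f w - f z) < e.
Proof.
split.
- move=> h e e0.
  have : nbhs (f z) [set w | normc (w - f z) < e] by apply/nbhsCP; exists e.
  by move=> /h /nbhsCP.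
- move=> h P /nbhsCP[e e0 H]; have [d d0 K] := h e e0.
  by apply/nbhsCP; exists d => // w /K /H.
Qed.

Lemma contCRP (f : C -> R) z : {for z, continuous f} <->
  forall e, 0 < e -> exists2 d : R, 0 < d &
    forall w, normc (w - z) < d -> `|f w - f z| < e.
Proof.
split.
- move=> /cvgrPdist_lt h e e0; have /nbhsCP[d d0 H] := h e e0.
  by exists d => // w /H; rewrite /= distrC.
- move=> h P /nbhs_normP[e e0 H]; have [d d0 K] := h e e0.
  by apply/nbhsCP; exists d => // w /K Kw; apply: H; rewrite /= distrC.
Qed.

Lemma contRCP (f : R -> C) x : {for x, continuous f} <->
  forall e, 0 < e -> exists2 d : R, 0 < d &
    forall y, `|y - x| < d -> normc (f y - f x) < e.
Proof.
split.
- move=> h e e0.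
  have : nbhs (f x) [set w | normc (w - f x) < e] by apply/nbhsCP; exists e.
  move=> /h /nbhs_normP [d d0 H]; exists d => // y hy; apply: H => /=.
  by rewrite distrC.
- move=> h P /nbhsCP[e e0 H]; have [d d0 K] := h e e0.
  apply/nbhs_normP; exists d => // y /= hy; apply: H; apply: K.
  by rewrite distrC.
Qed.

Lemma cont_Re z : {for z, continuous Re}.
Proof.
apply/contCRP => e e0; exists e => // w; rewrite -ReN -ReD.
exact/le_lt_trans/normc_Re.
Qed.

Lemma cont_Im z : {for z, continuous Im}.
Proof.
apply/contCRP => e e0; exists e => // w; rewrite -ImN -ImD.
exact/le_lt_trans/normc_Im.
Qed.

Lemma cont_conj z : {for z, continuous cj}.
Proof.
by apply/contCP => e e0; exists e => // w; rewrite -conjcB normc_conj.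
Qed.

Lemma cont_normc z : {for z, continuous (@normc R)}.
Proof.
apply/contCRP => e e0; exists e => // w; apply: le_lt_trans.
by rewrite ler_norml normc_sub_ge andbT lerNl opprB normc_distC normc_sub_ge.
Qed.

Lemma cont_complex (f g : C -> R) z :
  {for z, continuous f} -> {for z, continuous g} ->
  {for z, continuous (fun w => f w +i* g w : C)}.
Proof.
move=> /contCRP hf /contCRP hg; apply/contCP => e e0.
have e2 : 0 < e / 2 by rewrite divr_gt0.
have [d d0 Hf] := hf _ e2; have [d' d'0 Hg] := hg _ e2.
exists (Num.min d d') => [|w]; first by rewrite lt_min d0.
rewrite lt_min => /andP[/Hf h1 /Hg h2].
apply: le_lt_trans (normc_le_ReIm _) _ => /=; lra.
Qed.

Lemma contRC_complex (f g : R -> R) (x : R) :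
  {for x, continuous f} -> {for x, continuous g} ->
  {for x, continuous (fun y : R => f y +i* g y : C)}.
Proof.
move=> /cvgrPdist_lt hf /cvgrPdist_lt hg; apply/contRCP => e e0.
have e2 : 0 < e / 2 by rewrite divr_gt0.
have /nbhs_normP [d /= d0 Hf] := hf _ e2.
have /nbhs_normP [d' /= d'0 Hg] := hg _ e2.
exists (Num.min d d') => [|w]; first by rewrite lt_min d0.
rewrite lt_min distrC => /andP[h1 h2].
apply: le_lt_trans (normc_le_ReIm ((f w +i* g w) - (f x +i* g x))) _ => /=.
have /= := Hf w h1; have /= := Hg w h2.
rewrite (distrC (f x)) (distrC (g x)); lra.
Qed.

End ComplexBasics.

(** * Integration of continuous functions through antiderivatives *)

Section RealIntegral.
Variable R : realType.
Implicit Types (a b c x y K : R) (u v F : R -> R).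

Lemma mean_value F f a b : a <= b ->
  (forall x, a <= x <= b -> is_derive x 1 F (f x)) ->
  exists2 c, a <= c <= b & F b - F a = f c * (b - a).
Proof.
move=> ab h.
have h1 x : x \in `]a, b[%R -> is_derive x 1 F (f x).
  by rewrite in_itv/= => /andP[ax xb]; apply: h; rewrite !ltW.
have h2 : {within `[a, b], continuous F}.
  apply: derivable_within_continuous => x; rewrite in_itv/= => /h hx.
  by case: hx.
have [c cab ->] := MVT_segment ab h1 h2.
by exists c => //; move: cab; rewrite in_itv.
Qed.

(** The integral from a fixed base point is an antiderivative only to the right of that point. The
    base point [A x] therefore moves with [x], and subtracting the value at 0 makes the result
    independent of it. *)
Lemma antider_exists u : continuous u -> exists U, forall x, is_derive x 1 U (u x).
Proof.
move=> cu.
pose P a x : R := (\int[lebesgue_measure]_(t in `[a, x]) u t)%R.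
have PD a x : a < x -> is_derive x 1 (P a) (u x).
  move=> ax; have x1 : x < x + 1 by rewrite ltrDl.
  have [] := @continuous_FTC1_closed R u a x (x + 1) x1 _ ax (cu x).
    apply: continuous_compact_integrable; first exact: segment_compact.
    exact: continuous_subspaceT.
  by move=> d e; apply: DeriveDef; [exact: d|rewrite -derive1E; exact: e].
have Pe0 a b x y : a < x -> b < x -> x <= y -> P a y - P a x = P b y - P b x.
  move=> ax bx xy.
  have [z _] := mean_value (F := fun t => P a t - P b t) (f := fun t => u t - u t) xy
    (fun t ht => is_deriveB (PD a _ (lt_le_trans ax (proj1 (andP ht))))
                            (PD b _ (lt_le_trans bx (proj1 (andP ht))))).
  rewrite subrr mul0r; lra.
have Pe a b x y : a < x -> b < x -> a < y -> b < y ->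
    P a y - P a x = P b y - P b x.
  move=> ax bx ay byy; have [xy|/ltW yx] := leP x y; first exact: Pe0.
  by have := Pe0 a b y x ay byy yx; lra.
pose A x := - (`|x| + 1).
pose U x := P (A x) x - P (A x) 0.
exists U => x.
(* This base point lies to the left of 0 and of every [y] within distance 1 of [x], so near [x] the
   function [U] is the antiderivative based at [b]. *)
pose b := - (`|x| + 2).
have bx : b < x by have := ler_norm (- x); rewrite /b normrN; lra.
have b0 : b < 0 by have := normr_ge0 x; rewrite /b; lra.
have : is_derive x 1 (fun t => P b t - P b 0) (u x).
  have h := PD _ _ bx; rewrite -[u x]subr0; exact: is_deriveB.
apply: near_eq_is_derive.
near=> y.
have yx1 : `|x - y| < 1.
  by near: y; apply: nbhsx_ballx.
have y0 := normr_ge0 y; have x0 := normr_ge0 x.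
have y1 := ler_norm (- y); have x1 := ler_norm (- x).
have xy1 := ler_norm (x - y); rewrite !normrN in x1 y1.
by rewrite /U; apply: Pe; rewrite /A /b; lra.
Unshelve. all: by end_near. Qed.

(** Integrals are increments of a chosen antiderivative: additivity over intervals and reversal of
    orientation are then pure arithmetic, for any order of the endpoints. *)
Definition antider u : R -> R :=
  if pselect (exists U, forall x, is_derive x 1 U (u x)) is left h
  then projT1 (cid h) else cst 0.

(* Meaningful only if u has an antiderivative, in particular if u is continuous. *)
Definition rint u a b : R := antider u b - antider u a.

Lemma antiderP u : continuous u -> forall x, is_derive x 1 (antider u) (u x).
Proof.
move=> /antider_exists h; rewrite /antider; case: pselect => // h'.
by case: cid.
Qed.

Lemma rint_chasles u a b c : rint u a b + rint u b c = rint u a c.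
Proof. by rewrite /rint; lra. Qed.

Lemma rintN u a b : rint u b a = - rint u a b.
Proof. by rewrite /rint; lra. Qed.

Lemma rint_eq u F a b : continuous u -> a <= b ->
  (forall x, a <= x <= b -> is_derive x 1 F (u x)) -> rint u a b = F b - F a.
Proof.
move=> cu ab h.
have [c _] := mean_value (F := fun t => antider u t - F t) (f := fun t => u t - u t) ab
  (fun t ht => is_deriveB (antiderP cu t) (h t ht)).
rewrite /rint subrr mul0r; lra.
Qed.

Lemma rintB u v a b : continuous u -> continuous v -> a <= b ->
  rint (fun x => u x - v x) a b = rint u a b - rint v a b.
Proof.
move=> cu cv ab.
have cuv : continuous (fun x => u x - v x).
  by move=> x; apply: cvgB; [exact: cu|exact: cv].
have d x : a <= x <= b ->
    is_derive x 1 (fun t => antider u t - antider v t) (u x - v x).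
  by move=> _; apply: is_deriveB; exact: antiderP.
by rewrite (rint_eq cuv ab d) /rint; lra.
Qed.

Lemma rint_bound u a b K : continuous u -> a <= b ->
  (forall x, a <= x <= b -> `|u x| <= K) -> `|rint u a b| <= K * (b - a).
Proof.
move=> cu ab h.
have [c cab] := mean_value ab (fun t _ => antiderP cu t).
rewrite /rint => ->; rewrite normrM (ger0_norm (x := b - a)) ?subr_ge0//.
by rewrite ler_wpM2r ?subr_ge0// h.
Qed.

Lemma rint_cst k a b : rint (fun=> k) a b = k * (b - a).
Proof.
have ck : continuous (fun _ : R => k) by move=> x; exact: cvg_cst.
have h x : is_derive x 1 (fun t : R => k * t) k.
  by have := is_deriveZ (f := @id R) k (is_derive_id x 1); rewrite /GRing.scale/= mulr1.
have H x y : x <= y -> rint (fun=> k) x y = k * (y - x).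
  by move=> xy; rewrite (rint_eq ck xy (fun t _ => h t)) mulrBr.
have [|/ltW ab] := leP a b; first exact: H.
by rewrite rintN H//; lra.
Qed.

End RealIntegral.

(** * Complex derivatives and line integrals *)

Section ComplexDerivative.
Variable R : realType.
Notation C := R[i].
Notation Re := (@complex.Re R).
Notation Im := (@complex.Im R).
Notation cj := (@conjc R).
Implicit Types (f g : C -> C) (z w l : C).

(** The division-free form of complex differentiability; the non-strict inequality lets it include
    [w = z]. *)
Definition HasD f z l := forall e : R, 0 < e -> exists2 d : R, 0 < d &
  forall w, normc (w - z) < d ->
    normc (f w - f z - l * (w - z)) <= e * normc (w - z).

(* Caratheodory's form, from which the product and chain rules are immediate. *)
Lemma HasDP f z l : HasD f z l <-> exists phi : C -> C,
  [/\ {for z, continuous phi}, phi z = l &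
      forall w, f w - f z = phi w * (w - z)].
Proof.
split.
- move=> h; exists (fun w => if w == z then l else (f w - f z) / (w - z)).
  rewrite eqxx; split; [|by []|].
  + apply/contCP => e e0; have [d d0 H] := h (e / 2) (divr_gt0 e0 (ltr0Sn R 1)).
    exists d => // w hw; rewrite eqxx; case: eqVneq => [_|wz].
      by rewrite subrr normc0.
    have wz0 : w - z != 0 by rewrite subr_eq0.
    have -> : (f w - f z) / (w - z) - l = (f w - f z - l * (w - z)) / (w - z).
      by field.
    rewrite normcM normcV ltr_pdivrMr ?normc_gt0//.
    apply: le_lt_trans (H _ hw) _; rewrite ltr_pM2r ?normc_gt0//; lra.
  + move=> w; case: eqVneq => [->|wz]; first by rewrite !subrr mulr0.
    by rewrite divfK// subr_eq0.
- move=> [phi [/contCP c <- h]] e /c [d d0 H]; exists d => // w /H /ltW hw.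
  by rewrite h -mulrBl normcM ler_wpM2r// normc_ge0.
Qed.

Lemma HasD_cont f z l : HasD f z l -> {for z, continuous f}.
Proof.
move=> /HasDP[phi [c pz h]].
have -> : f = (fun w => phi w * (w - z) + f z).
  by apply/funext => w; rewrite -h subrK.
have c2 : {for z, continuous (fun w : C => w - z)}.
  by apply: (cvgB cvg_id); exact: cvg_cst.
exact: (cvgD (cvgM c c2) (cvg_cst _)).
Qed.

Lemma HasD_cst (k : C) z : HasD (fun=> k) z 0.
Proof. by move=> e e0; exists 1 => // w _; rewrite subrr mul0r subrr normc0 mulr_ge0 ?normc_ge0// ltW. Qed.

Lemma HasD_id z : HasD id z 1.
Proof. by move=> e e0; exists 1 => // w _; rewrite mul1r subrr normc0 mulr_ge0 ?normc_ge0// ltW. Qed.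

Lemma HasD_D f g z l k : HasD f z l -> HasD g z k ->
  HasD (fun w => f w + g w) z (l + k).
Proof.
move=> /HasDP[p [cp <- hp]] /HasDP[q [cq <- hq]]; apply/HasDP.
exists (fun w => p w + q w); split; [exact: (cvgD cp cq)|by []|].
move=> w; rewrite mulrDl -hp -hq; ring.
Qed.

Lemma HasD_M f g z l k : HasD f z l -> HasD g z k ->
  HasD (fun w => f w * g w) z (l * g z + f z * k).
Proof.
move=> /[dup] /HasD_cont cf /HasDP[p [cp <- hp]] /HasDP[q [cq <- hq]].
apply/HasDP; exists (fun w => p w * g z + f w * q w); split.
- exact: (cvgD (cvgM cp (cvg_cst _)) (cvgM cf cq)).
- by [].
move=> w; rewrite mulrDl [p w * g z]mulrC -!mulrA -hp -hq; ring.
Qed.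

Lemma HasD_V f z l : HasD f z l -> f z != 0 ->
  HasD (fun w => (f w)^-1) z (- l / f z ^+ 2).
Proof.
move=> /[dup] /HasD_cont cf hf fz; apply/HasDP.
have [d d0 H] : exists2 d : R, 0 < d & forall w, normc (w - z) < d -> f w != 0.
  have /contCP /(_ (normc (f z))) := cf; rewrite normc_gt0 => /(_ fz)[d d0 H].
  exists d => // w /H; apply: contraTN => /eqP ->.
  by rewrite sub0r normcN ltxx.
have /HasDP[p [cp pl hp]] := hf.
have cV : {for z, continuous (fun w => (f w)^-1)} by exact: (cvgV fz cf).
(* The factorization must hold at every [w], also where [f w = 0] and the inverse is 0 by
   convention. Such points stay away from [z], so the extra branch does not affect continuity at
   [z]. *)
exists (fun w => if f w == 0 then (- (f z)^-1) / (w - z)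
                 else - p w * (f w)^-1 * (f z)^-1).
rewrite (negbTE fz); split.
- apply/contCP => e e0.
  have /contCP /(_ e e0)[d' d'0 K] : {for z, continuous
      (fun w => - p w * (f w)^-1 * (f z)^-1)}.
    exact: (cvgM (cvgM (cvgN cp) cV) (cvg_cst _)).
  exists (Num.min d d') => [|w]; first by rewrite lt_min d0.
  rewrite lt_min => /andP[/H fw /K].
  by rewrite (negbTE fz) (negbTE fw).
- by rewrite pl; field.
- move=> w; case: eqVneq => [fw|fw].
    have wz : w - z != 0.
      by rewrite subr_eq0; apply: contraNneq fz => <-; rewrite fw.
    by rewrite fw invr0 sub0r divfK.
  have -> : - p w * (f w)^-1 * (f z)^-1 * (w - z) =
            - (p w * (w - z)) * (f w)^-1 * (f z)^-1 by ring.
  by rewrite -hp; field; rewrite fw fz.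
Qed.

Lemma HasD_comp f g z l k : HasD f z l -> HasD g (f z) k ->
  HasD (fun w => g (f w)) z (k * l).
Proof.
move=> /[dup] /HasD_cont cf /HasDP[p [cp <- hp]] /HasDP[q [cq <- hq]].
apply/HasDP; exists (fun w => q (f w) * p w).
split; [exact: (cvgM (continuous_comp cf cq) cp)|by []|].
by move=> w; rewrite hq hp mulrA.
Qed.

Lemma HasD_conj f z l : HasD f (cj z) l -> HasD (fun w => cj (f (cj w))) z (cj l).
Proof.
move=> h e e0; have [d d0 H] := h e e0; exists d => // w hw.
have E : normc (cj w - cj z) = normc (w - z) by rewrite -conjcB normc_conj.
have := H (cj w); rewrite E => /(_ hw).
have -> : cj (f (cj w)) - cj (f (cj z)) - cj l * (w - z) =
          cj (f (cj w) - f (cj z) - l * (cj w - cj z)).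
  by rewrite conjcB conjcB conjcM conjcB !conjcK.
by rewrite normc_conj.
Qed.

Lemma HasD_near f g z l (d : R) : 0 < d ->
  (forall w, normc (w - z) < d -> f w = g w) -> HasD f z l -> HasD g z l.
Proof.
move=> d0 fg h e e0; have [d' d'0 H] := h e e0.
exists (Num.min d d') => [|w]; first by rewrite lt_min d0.
rewrite lt_min => /andP[h1 h2]; rewrite -!fg//; first exact: H.
by rewrite subrr normc0.
Qed.

Lemma derivable_HasD f z : derivable f z 1 -> exists l, HasD f z l.
Proof.
move=> /cvg_ex [l hl]; exists l => e e0.
have : nbhs l [set k | normc (k - l) < e] by apply/nbhsCP; exists e.
move=> /hl; rewrite /nbhs /= /dnbhs /within /= => /nbhsCP[d d0 H].
exists d => // w hw.
have [->|wz] := eqVneq w z; first by rewrite !subrr mulr0 subr0 normc0 mulr0.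
have wz0 : w - z != 0 by rewrite subr_eq0.
have := H (w - z); rewrite subr0 => /(_ hw wz0).
rewrite /GRing.scale /= mulr1 subrK => hh.
have -> : f w - f z - l * (w - z) = ((w - z)^-1 * (f w - f z) - l) * (w - z).
  by field.
by rewrite normcM ler_wpM2r ?normc_ge0// ltW.
Qed.

End ComplexDerivative.

(** * Integrals of complex functions along horizontal and vertical segments *)

Section LineIntegral.
Variable R : realType.
Notation C := R[i].
Notation Re := (@complex.Re R).
Notation Im := (@complex.Im R).

Lemma is_deriveP_eps (F : R -> R) (x l : R) :
  (forall e : R, 0 < e -> exists2 d : R, 0 < d & forall y, `|y - x| < d ->
     `|F y - F x - l * (y - x)| <= e * `|y - x|) -> is_derive x 1 F l.
Proof.
move=> h.
have H : (fun k : R => k^-1 *: (F (k *: 1 + x) - F x)) @ 0^' --> l.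
  apply/cvgrPdist_le => e e0; have [d d0 K] := h e e0.
  rewrite near_withinE; near=> k => k0.
  have kd : `|0 - k| < d by near: k; apply: nbhsx_ballx.
  have := K (k + x); rewrite addrK; move: kd; rewrite sub0r normrN => kd /(_ kd).
  rewrite /GRing.scale /= mulr1 => hh.
  have -> : l - k^-1 * (F (k + x) - F x) = - (F (k + x) - F x - l * k) / k.
    by field.
  by rewrite normrM normrN normfV ler_pdivrMr ?normr_gt0.
apply: DeriveDef; first by apply/cvg_ex; exists l.
by apply: cvg_lim => //; exact: norm_hausdorff.
Unshelve. all: by end_near. Qed.

Lemma HasD_along (F : C -> C) (p v l : C) (t : R) : HasD F (p + t%:C * v) l ->
  is_derive t 1 (fun s : R => Re (F (p + s%:C * v))) (Re (l * v)) /\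
  is_derive t 1 (fun s : R => Im (F (p + s%:C * v))) (Im (l * v)).
Proof.
(* One argument for any real-linear functional bounded by the modulus, applied below to the real and
   imaginary parts. Dividing by [normc v + 1] rather than [normc v] covers [v = 0]. *)
move=> h; have key (L : C -> R) : (forall x y, L (x + y) = L x + L y) ->
    (forall x, L (- x) = - L x) -> (forall x, `|L x| <= normc x) ->
    (forall (r : R) x, L (r%:C * x) = r * L x) ->
    is_derive t 1 (fun s : R => L (F (p + s%:C * v))) (L (l * v)).
  move=> LD LN Lb LZ; apply: is_deriveP_eps => e e0.
  have v0 : 0 < normc v + 1 by rewrite ltr_wpDl ?normc_ge0.
  have [d d0 H] := h _ (divr_gt0 e0 v0).
  exists (d / (normc v + 1)); first by rewrite divr_gt0.
  move=> y hy; pose w := p + y%:C * v; pose z := p + t%:C * v.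
  have E : w - z = (y - t)%:C * v by rewrite /w /z rmorphB; ring.
  have N : normc (w - z) = `|y - t| * normc v by rewrite E normcM normc_real.
  have b : `|y - t| * normc v <= `|y - t| * (normc v + 1).
    by rewrite ler_wpM2l// lerDl.
  have hw : normc (w - z) < d.
    by rewrite N; apply: le_lt_trans b _; rewrite -ltr_pdivlMr.
  have := H w hw; rewrite -/z N E.
  have -> : L (F w) - L (F z) - L (l * v) * (y - t) =
            L (F w - F z - l * ((y - t)%:C * v)).
    by rewrite !LD !LN (_ : l * ((y - t)%:C * v) = (y - t)%:C * (l * v)) ?LZ; ring.
  move=> hh; apply: le_trans (Lb _) _; apply: le_trans hh _.
  apply: le_trans (ler_wpM2l _ b) _; first by rewrite ltW// divr_gt0.
  by rewrite mulrCA divfK ?lt0r_neq0// mulrC.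
split; apply: key.
- exact: ReD.
- exact: ReN.
- exact: normc_Re.
- by move=> r x; rewrite ReM /= mul0r subr0.
- exact: ImD.
- exact: ImN.
- exact: normc_Im.
- by move=> r x; rewrite ImM /= mul0r addr0.
Qed.

Implicit Types (g : R -> C) (a b K : R).

Definition cint g a b : C := rint (Re \o g) a b +i* rint (Im \o g) a b.

Definition contRC g := forall t, {for t, continuous g}.

Lemma contRC_Re g : contRC g -> continuous (Re \o g).
Proof. by move=> h t; exact: (continuous_comp (h t) (@cont_Re R _)). Qed.

Lemma contRC_Im g : contRC g -> continuous (Im \o g).
Proof. by move=> h t; exact: (continuous_comp (h t) (@cont_Im R _)). Qed.

Lemma cint_chasles g a b c : cint g a b + cint g b c = cint g a c.
Proof. by rewrite /cint; simpc; rewrite !rint_chasles. Qed.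

Lemma cintN g a b : cint g b a = - cint g a b.
Proof. by apply: eq_ReIm; rewrite ?ReN ?ImN /= rintN. Qed.

Lemma cintB g h a b : contRC g -> contRC h -> a <= b ->
  cint (fun t => g t - h t) a b = cint g a b - cint h a b.
Proof.
move=> cg ch ab; apply: eq_ReIm; rewrite ?ReD ?ImD ?ReN ?ImN /=.
- rewrite -rintB //; [|exact: contRC_Re..].
  by congr rint; apply/funext => t /=; rewrite ReD ReN.
- rewrite -rintB //; [|exact: contRC_Im..].
  by congr rint; apply/funext => t /=; rewrite ImD ImN.
Qed.

(** The factor 2 comes from estimating real and imaginary parts separately; only the order of the
    bound matters later. *)
Lemma cint_bound g a b K : contRC g -> a <= b ->
  (forall t, a <= t <= b -> normc (g t) <= K) ->
  normc (cint g a b) <= 2 * K * (b - a).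
Proof.
move=> cg ab h; apply: le_trans (normc_le_ReIm _) _ => /=.
have h1 : `|rint (Re \o g) a b| <= K * (b - a).
  apply: rint_bound => //; first exact: contRC_Re.
  by move=> t /h; exact: le_trans (normc_Re (g t)).
have h2 : `|rint (Im \o g) a b| <= K * (b - a).
  apply: rint_bound => //; first exact: contRC_Im.
  by move=> t /h; exact: le_trans (normc_Im (g t)).
by lra.
Qed.

Lemma cint_cst (k : C) a b : cint (fun=> k) a b = k * (b - a)%:C.
Proof.
rewrite /cint /comp !rint_cst; case: k => p q /=; simpc.
by congr (_ +i* _); ring.
Qed.

Lemma cint_primitive_h (F f : C -> C) (y a b : R) :
  contRC (fun t => f (t +i* y)) -> a <= b ->
  (forall t, a <= t <= b -> HasD F (t +i* y) (f (t +i* y))) ->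
  cint (fun t => f (t +i* y)) a b = F (b +i* y) - F (a +i* y).
Proof.
move=> cf ab h.
have E (t : R) : (0 +i* y) + t%:C * 1 = t +i* y by simpc.
have H t : a <= t <= b -> HasD F ((0 +i* y) + t%:C * 1) (f (t +i* y)).
  by rewrite E; exact: h.
have D1 t (ht : a <= t <= b) := (HasD_along (H t ht)).1.
have D2 t (ht : a <= t <= b) := (HasD_along (H t ht)).2.
have I1 : rint (Re \o (fun t => f (t +i* y))) a b =
    Re (F ((0 +i* y) + b%:C * 1)) - Re (F ((0 +i* y) + a%:C * 1)).
  apply: (rint_eq (F := fun s => Re (F ((0 +i* y) + s%:C * 1))) _ ab).
    exact: contRC_Re.
  by move=> t /D1; rewrite mulr1.
have I2 : rint (Im \o (fun t => f (t +i* y))) a b =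
    Im (F ((0 +i* y) + b%:C * 1)) - Im (F ((0 +i* y) + a%:C * 1)).
  apply: (rint_eq (F := fun s => Im (F ((0 +i* y) + s%:C * 1))) _ ab).
    exact: contRC_Im.
  by move=> t /D2; rewrite mulr1.
rewrite /cint I1 I2 !E.
by apply: eq_ReIm; rewrite /= ?ReD ?ReN ?ImD ?ImN.
Qed.

Lemma cint_primitive_v (F f : C -> C) (x a b : R) :
  contRC (fun t => f (x +i* t)) -> a <= b ->
  (forall t, a <= t <= b -> HasD F (x +i* t) (f (x +i* t))) ->
  (0 +i* 1) * cint (fun t => f (x +i* t)) a b = F (x +i* b) - F (x +i* a).
Proof.
move=> cf ab h.
have E (t : R) : (x +i* 0) + t%:C * (0 +i* 1) = x +i* t by simpc.
have H t : a <= t <= b ->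
    HasD F ((x +i* 0) + t%:C * (0 +i* 1)) (f (x +i* t)).
  by rewrite E; exact: h.
have D1 t (ht : a <= t <= b) := (HasD_along (H t ht)).1.
have D2 t (ht : a <= t <= b) := (HasD_along (H t ht)).2.
have I1 : rint (Re \o (fun t => f (x +i* t))) a b =
    Im (F ((x +i* 0) + b%:C * (0 +i* 1))) - Im (F ((x +i* 0) + a%:C * (0 +i* 1))).
  apply: (rint_eq (F := fun s => Im (F ((x +i* 0) + s%:C * (0 +i* 1)))) _ ab).
    exact: contRC_Re.
  move=> t /D2; congr (is_derive _ _ _ _).
  by rewrite ImM /=; ring.
have I2 : rint (Im \o (fun t => f (x +i* t))) a b =
    - Re (F ((x +i* 0) + b%:C * (0 +i* 1))) - - Re (F ((x +i* 0) + a%:C * (0 +i* 1))).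
  apply: (rint_eq (F := fun s => - Re (F ((x +i* 0) + s%:C * (0 +i* 1)))) _ ab).
    exact: contRC_Im.
  move=> t /D1 d; have := is_deriveN d; congr (is_derive _ _ _ _).
  by rewrite ReM /=; ring.
rewrite /cint I1 I2 !E.
by apply: eq_ReIm; rewrite ?ReM ?ImM /= ?ReD ?ReN ?ImD ?ImN; ring.
Qed.

End LineIntegral.

(** * Goursat's theorem on rectangles *)

Lemma nested_intervals (R : realType) (u v : nat -> R) :
  (forall n, u n <= u n.+1) -> (forall n, v n.+1 <= v n) ->
  (forall n, u n <= v n) -> exists p, forall n, u n <= p <= v n.
Proof.
move=> hu hv uv.
have mu m n : (m <= n)%N -> u m <= u n by exact: (homo_leq (@lexx _ _) (@le_trans _ _)).
have mv m n : (m <= n)%N -> v n <= v m.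
  by apply: (homo_leq (r := fun x y => y <= x)) => // x y z h1 h2; exact: le_trans h2 h1.
have uvm m n : u m <= v n.
  apply: le_trans (mu _ _ (leq_maxl m n)) _.
  by apply: le_trans (uv _) _; apply: mv; exact: leq_maxr.
have hs : has_sup (range u).
  by split; [exists (u 0%N), 0%N|exists (v 0%N) => _ [m _ <-]].
exists (sup (range u)) => n; apply/andP; split.
- by apply: ub_le_sup; [case: hs|exists n].
- by apply: ge_sup; [case: hs|move=> _ [m _ <-]].
Qed.

Lemma exists_expr2_lt (R : realType) (w d : R) : 0 < d ->
  exists n, w / 2 ^+ n < d.
Proof.
move=> d0; have [w0|w0] := ltP w 0.
  by exists 0%N; rewrite expr0 divr1; exact: lt_trans d0.
exists (Num.bound (w / d)); rewrite ltr_pdivrMr ?exprn_gt0//.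
rewrite mulrC -ltr_pdivrMr//.
apply: lt_trans (archi_boundP _) _; first by rewrite divr_ge0// ltW.
by rewrite -natrX ltr_nat ltn_expl.
Qed.

Section Bisection.
Variable R : realType.
Notation C := R[i].

(** The core of Goursat's argument for an arbitrary additive function of rectangles: each quartering
    multiplies the number of pieces by 4 and divides the squared size by 4, so a local bound that is
    small relative to the squared size forces the value 0. *)
Lemma bisection (E : R -> R -> R -> R -> C) (a b c d : R) :
  a <= b -> c <= d ->
  (forall x1 x2 x3 y1 y2, E x1 x2 y1 y2 + E x2 x3 y1 y2 = E x1 x3 y1 y2) ->
  (forall x1 x2 y1 y2 y3, E x1 x2 y1 y2 + E x1 x2 y2 y3 = E x1 x2 y1 y3) ->
  (forall p q, a <= p <= b -> c <= q <= d -> forall e : R, 0 < e ->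
    exists2 del : R, 0 < del & forall x1 x2 y1 y2,
      x1 <= p <= x2 -> y1 <= q <= y2 -> x2 - x1 < del -> y2 - y1 < del ->
      normc (E x1 x2 y1 y2) <= e * ((x2 - x1) + (y2 - y1)) ^+ 2) ->
  E a b c d = 0.
Proof.
move=> ab cd Ex Ey loc.
pose N (s : (R * R) * (R * R)) := normc (E s.1.1 s.1.2 s.2.1 s.2.2).
(* A rectangle is followed by one of its four quarters that carries at least a quarter of the
   modulus. *)
pose sub (s s' : (R * R) * (R * R)) :=
  [/\ s'.1 = (s.1.1, (s.1.1 + s.1.2) / 2) \/ s'.1 = ((s.1.1 + s.1.2) / 2, s.1.2),
      s'.2 = (s.2.1, (s.2.1 + s.2.2) / 2) \/ s'.2 = ((s.2.1 + s.2.2) / 2, s.2.2) &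
      N s <= 4 * N s'].
have /choice[f hf] : forall s, exists s', sub s s'.
  move=> [[x1 x2] [y1 y2]]; pose m := (x1 + x2) / 2; pose k := (y1 + y2) / 2.
  have le : N ((x1, x2), (y1, y2)) <= N ((x1, m), (y1, k)) + N ((x1, m), (k, y2))
      + N ((m, x2), (y1, k)) + N ((m, x2), (k, y2)).
    rewrite /N /= -(Ex x1 m x2) -(Ey x1 m y1 k y2) -(Ey m x2 y1 k y2).
    apply: le_trans (normc_triangle _ _) _; rewrite -addrA.
    by apply: lerD; exact: normc_triangle.
  have [h1|h1] := leP (N ((x1, x2), (y1, y2))) (4 * N ((x1, m), (y1, k))).
    by exists ((x1, m), (y1, k)); split => //=; left.
  have [h2|h2] := leP (N ((x1, x2), (y1, y2))) (4 * N ((x1, m), (k, y2))).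
    by exists ((x1, m), (k, y2)); split => //=; [left|right].
  have [h3|h3] := leP (N ((x1, x2), (y1, y2))) (4 * N ((m, x2), (y1, k))).
    by exists ((m, x2), (y1, k)); split => //=; [right|left].
  exists ((m, x2), (k, y2)); split => /=; [by right|by right|lra].
pose s n := iter n f ((a, b), (c, d)).
have sS n : sub (s n) (s n.+1) by exact: hf.
have ordn n : (s n).1.1 <= (s n).1.2 /\ (s n).2.1 <= (s n).2.2.
  elim: n => [|n [i1 i2]]; first by [].
  by have [h1 h2 _] := sS n; split; [case: h1|case: h2] => -> /=; lra.
have [p hp] : exists p, forall n, (s n).1.1 <= p <= (s n).1.2.
  apply: nested_intervals => n; have [i1 i2] := ordn n; have [h1 h2 _] := sS n => //;
  by case: h1 => -> /=; lra.
have [q hq] : exists q, forall n, (s n).2.1 <= q <= (s n).2.2.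
  apply: nested_intervals => n; have [i1 i2] := ordn n; have [h1 h2 _] := sS n => //;
  by case: h2 => -> /=; lra.
have w1 n : (s n).1.2 - (s n).1.1 = (b - a) / 2 ^+ n.
  elim: n => [|n ih]; first by rewrite expr0 divr1.
  rewrite exprS invfM mulrCA -ih; have [h1 _ _] := sS n.
  by case: h1 => -> /=; lra.
have w2 n : (s n).2.2 - (s n).2.1 = (d - c) / 2 ^+ n.
  elim: n => [|n ih]; first by rewrite expr0 divr1.
  rewrite exprS invfM mulrCA -ih; have [_ h2 _] := sS n.
  by case: h2 => -> /=; lra.
have Nn n : N (s 0%N) <= 4 ^+ n * N (s n).
  elim: n => [|n ih]; first by rewrite expr0 mul1r.
  apply: le_trans ih _; rewrite exprSr -mulrA ler_wpM2l ?exprn_ge0//.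
  by have [] := sS n.
pose W := (b - a) + (d - c).
have W0 : 0 <= W by rewrite /W; lra.
have main e : 0 < e -> N (s 0%N) <= e * W ^+ 2.
  move=> e0; have [del del0 H] := loc p q (hp 0%N) (hq 0%N) e e0.
  have [n hn] := exists_expr2_lt W del0.
  have pn : 0 < (2 : R)^-1 ^+ n by rewrite exprn_gt0// invr_gt0.
  rewrite -exprVn in hn.
  have := H _ _ _ _ (hp n) (hq n); rewrite w1 w2 -!exprVn.
  have l1 : (b - a) * 2^-1 ^+ n < del.
    by apply: le_lt_trans hn; rewrite ler_pM2r// /W; lra.
  have l2 : (d - c) * 2^-1 ^+ n < del.
    by apply: le_lt_trans hn; rewrite ler_pM2r// /W; lra.
  move=> /(_ l1 l2) hN; apply: le_trans (Nn n) _.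
  apply: le_trans (ler_wpM2l _ hN) _; first by rewrite exprn_ge0.
  have E4 : 4 ^+ n * (2^-1 ^+ n) ^+ 2 = 1 :> R.
    rewrite -exprM mulnC exprM -exprMn.
    have -> : 4 * 2^-1 ^+ 2 = 1 :> R by field.
    by rewrite expr1n.
  rewrite -mulrDl -/W; move: E4; set r := 2^-1 ^+ n; set k := 4 ^+ n => E4.
  have -> : k * (e * (W * r) ^+ 2) = e * W ^+ 2 * (k * r ^+ 2) by ring.
  by rewrite E4 mulr1.
apply/eqP; rewrite -normc_eq0 -[normc _]/(N (s 0%N)).
apply/eqP/le_anti; rewrite normc_ge0 andbT leNgt; apply/negP => N0.
(* With this denominator the bound drops below half of the value to be excluded; adding 1 covers a
   degenerate rectangle, where [W = 0]. *)
have D0 : 0 < 2 * (W ^+ 2 + 1) by rewrite mulr_gt0// ltr_wpDl// sqr_ge0.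
have := main _ (divr_gt0 N0 D0); apply/negP; rewrite -ltNge.
rewrite mulrAC ltr_pdivrMr// ltr_pM2l//.
have := sqr_ge0 W; lra.
Qed.

End Bisection.

Section RectangleIntegral.
Variable R : realType.
Notation C := R[i].
Notation Re := (@complex.Re R).
Notation Im := (@complex.Im R).
Implicit Types (f g F : C -> C) (a b c d x y k K : R) (z w l : C).

Definition contCC f := forall z, {for z, continuous f}.

Lemma contCC_h f y : contCC f -> contRC (fun x => f (x +i* y)).
Proof.
move=> cf x; apply: (continuous_comp (f := fun x => x +i* y) (g := f)); last exact: cf.
by apply: contRC_complex; [exact: cvg_id|exact: cvg_cst].
Qed.

Lemma contCC_v f x : contCC f -> contRC (fun y => f (x +i* y)).
Proof.
move=> cf y; apply: (continuous_comp (f := fun y => x +i* y) (g := f)); last exact: cf.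
by apply: contRC_complex; [exact: cvg_cst|exact: cvg_id].
Qed.

(** The integral of [f dz] over the counterclockwise boundary of $[a,b]\times[c,d]$: bottom minus
    top, plus $i$ times right minus left. *)
Definition rectint f a b c d : C :=
  cint (fun x => f (x +i* c)) a b - cint (fun x => f (x +i* d)) a b +
  (0 +i* 1) * (cint (fun y => f (b +i* y)) c d - cint (fun y => f (a +i* y)) c d).

Lemma rectint_chasles_h f x1 x2 x3 y1 y2 :
  rectint f x1 x2 y1 y2 + rectint f x2 x3 y1 y2 = rectint f x1 x3 y1 y2.
Proof.
rewrite /rectint -(cint_chasles _ x1 x2 x3) -(cint_chasles (fun x => f (x +i* y2)) x1 x2 x3).
ring.
Qed.

Lemma rectint_chasles_v f x1 x2 y1 y2 y3 :
  rectint f x1 x2 y1 y2 + rectint f x1 x2 y2 y3 = rectint f x1 x2 y1 y3.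
Proof.
rewrite /rectint -(cint_chasles _ y1 y2 y3) -(cint_chasles (fun y => f (x1 +i* y)) y1 y2 y3).
ring.
Qed.

Lemma rectintN_h f a b c d : rectint f b a c d = - rectint f a b c d.
Proof. by rewrite /rectint (cintN _ a b) (cintN (fun x => f (x +i* d)) a b); ring. Qed.

Lemma rectintN_v f a b c d : rectint f a b d c = - rectint f a b c d.
Proof. by rewrite /rectint (cintN _ c d) (cintN (fun x => f (a +i* x)) c d); ring. Qed.

Lemma rectintB f g a b c d : contCC f -> contCC g -> a <= b -> c <= d ->
  rectint (fun z => f z - g z) a b c d = rectint f a b c d - rectint g a b c d.
Proof.
move=> cf cg ab cd; rewrite /rectint.
rewrite !cintB//; try exact: contCC_h; try exact: contCC_v.
ring.
Qed.

Lemma normc_ii (z : C) : normc ((0 +i* 1) * z) = normc z.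
Proof. by rewrite normcM /= expr0n expr1n /= add0r sqrtr1 mul1r. Qed.

Lemma rectint_bound f a b c d K : contCC f -> a <= b -> c <= d ->
  (forall x y, a <= x <= b -> c <= y <= d -> normc (f (x +i* y)) <= K) ->
  normc (rectint f a b c d) <= 4 * K * ((b - a) + (d - c)).
Proof.
move=> cf ab cd h.
have h1 y : c <= y <= d -> normc (cint (fun x => f (x +i* y)) a b) <= 2 * K * (b - a).
  by move=> hy; apply: cint_bound => //; [exact: contCC_h|move=> x hx; exact: h].
have h2 x : a <= x <= b -> normc (cint (fun y => f (x +i* y)) c d) <= 2 * K * (d - c).
  by move=> hx; apply: cint_bound => //; [exact: contCC_v|move=> y hy; exact: h].
apply: le_trans (normc_triangle _ _) _; rewrite normc_ii.
have e1 := normc_triangleB (cint (fun x => f (x +i* c)) a b) (cint (fun x => f (x +i* d)) a b).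
have e2 := normc_triangleB (cint (fun x => f (b +i* x)) c d) (cint (fun x => f (a +i* x)) c d).
have cc : c <= c <= d by rewrite lexx. have dd : c <= d <= d by rewrite lexx cd.
have aa : a <= a <= b by rewrite lexx. have bb : a <= b <= b by rewrite lexx ab.
by have := h1 c cc; have := h1 d dd; have := h2 a aa; have := h2 b bb; lra.
Qed.

Lemma rectint_primitive F f a b c d : contCC f -> a <= b -> c <= d ->
  (forall x y, a <= x <= b -> c <= y <= d -> HasD F (x +i* y) (f (x +i* y))) ->
  rectint f a b c d = 0.
Proof.
move=> cf ab cd h.
have cc : c <= c <= d by rewrite lexx. have dd : c <= d <= d by rewrite lexx cd.
have aa : a <= a <= b by rewrite lexx. have bb : a <= b <= b by rewrite lexx ab.
rewrite /rectint mulrBr.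
rewrite (cint_primitive_h (F := F) (contCC_h (y := _) cf) ab) => [|t ht]; last exact: h.
rewrite (cint_primitive_h (F := F) (contCC_h (y := _) cf) ab) => [|t ht]; last exact: h.
rewrite (cint_primitive_v (F := F) (contCC_v (x := _) cf) cd) => [|t ht]; last exact: h.
rewrite (cint_primitive_v (F := F) (contCC_v (x := _) cf) cd) => [|t ht]; last exact: h.
ring.
Qed.

(** The substitute for holomorphy at points where differentiability is unknown. It suffices for the
    vanishing of small rectangle integrals, and it is transported by a holomorphic change of
    variable. *)
Definition local_primitive f z := exists2 r : R, 0 < r &
  exists F, forall w, normc (w - z) < r -> HasD F w (f w).

Lemma affine_primitive (k l z0 z : C) :
  HasD (fun w => k * (w - z0) + l / 2 * ((w - z0) * (w - z0))) z (k + l * (z - z0)).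
Proof.
have h0 : HasD (fun w => w - z0) z 1.
  by rewrite -[1 in X in HasD _ _ X](addr0 (1 : C)); exact: HasD_D (HasD_id z) (HasD_cst _ _).
have := HasD_D (HasD_M (HasD_cst k z) h0) (HasD_M (HasD_cst (l / 2) z) (HasD_M h0 h0)).
by congr (HasD _ _ _); field.
Qed.

(** Around a point with a local primitive, small rectangles have integral 0. Around a point of
    differentiability the affine part has a primitive and drops out, and the remainder is small
    relative to the size, over a perimeter comparable to the size. The 4 in [e / 4] below absorbs
    the constant of [rectint_bound]. *)
Theorem cauchy_rect f a b c d : contCC f -> a <= b -> c <= d ->
  (forall x y, a <= x <= b -> c <= y <= d ->
     (exists l, HasD f (x +i* y) l) \/ local_primitive f (x +i* y)) ->
  rectint f a b c d = 0.
Proof.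
move=> cf ab cd h; apply: (bisection ab cd).
- by move=> *; exact: rectint_chasles_h.
- by move=> *; exact: rectint_chasles_v.
move=> p q hp hq e e0.
have near_pq (r : R) x1 x2 y1 y2 x y : x1 <= p <= x2 -> y1 <= q <= y2 ->
    x2 - x1 < r / 2 -> y2 - y1 < r / 2 -> x1 <= x <= x2 -> y1 <= y <= y2 ->
    normc ((x +i* y) - (p +i* q)) < r /\
    normc ((x +i* y) - (p +i* q)) <= (x2 - x1) + (y2 - y1).
  move=> hx hy wx wy hx' hy'.
  have N : normc ((x +i* y) - (p +i* q)) <= (x2 - x1) + (y2 - y1).
    apply: le_trans (normc_le_ReIm _) _; apply: lerD; rewrite ler_norml /=; lra.
  by split => //; apply: le_lt_trans N _; lra.
have [[l hl]|[r r0 [F hF]]] := h p q hp hq; last first.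
  exists (r / 2); first by rewrite divr_gt0.
  move=> x1 x2 y1 y2 hx hy wx wy.
  rewrite (rectint_primitive (F := F)) ?normc0//; first last.
  - move=> x y hx' hy'; apply: hF.
    by have [] := near_pq r x1 x2 y1 y2 x y hx hy wx wy hx' hy'.
  - lra.
  - lra.
  by rewrite mulr_ge0 ?sqr_ge0// ltW.
have e4 : 0 < e / 4 by rewrite divr_gt0.
have [r r0 H] := hl _ e4; exists (r / 2); first by rewrite divr_gt0.
move=> x1 x2 y1 y2 hx hy wx wy.
have x12 : x1 <= x2 by lra. have y12 : y1 <= y2 by lra.
set z0 := p +i* q in hl H.
pose A := fun z => f z0 + l * (z - z0).
have cA : contCC A.
  move=> z; exact: (cvgD (cvg_cst _) (cvgM (cvg_cst _) (cvgB cvg_id (cvg_cst _)))).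
have A0 : rectint A x1 x2 y1 y2 = 0.
  apply: (rectint_primitive _ x12 y12); first exact: cA.
  by move=> x y _ _; exact: affine_primitive.
have cfA : contCC (fun z => f z - A z) by move=> z; exact: (cvgB (cf z) (cA z)).
rewrite -[rectint f _ _ _ _]subr0 -A0 -rectintB//.
pose s := (x2 - x1) + (y2 - y1).
apply: le_trans (rectint_bound (K := e / 4 * s) cfA x12 y12 _) _.
  move=> x y hx' hy'.
  have [n1 n2] := near_pq r x1 x2 y1 y2 x y hx hy wx wy hx' hy'.
  have := H _ n1; rewrite /A opprD addrA => hh; apply: le_trans hh _.
  by rewrite ler_wpM2l// ltW.
by rewrite -/s; have -> : 4 * (e / 4 * s) * s = e * s ^+ 2 by field.
Qed.

End RectangleIntegral.

(** * Removability of lines *)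

Section LineRemoval.
Variable R : realType.
Notation C := R[i].
Notation Re := (@complex.Re R).
Notation Im := (@complex.Im R).
Implicit Types (f g F : C -> C) (a b c d x y k K : R) (z w l : C).

Lemma uniform_on_segment f a b k e : contCC f -> 0 < e ->
  exists2 d, 0 < d & forall x y, a <= x <= b -> `|y - k| < d ->
    normc (f (x +i* y) - f (x +i* k)) < e.
Proof.
move=> cf e0.
have /compact_near_coveringP/near_covering_withinP cov := @segment_compact R a b.
have : \forall y \near nbhs k, forall x, x \in `[a, b] ->
    normc (f (x +i* y) - f (x +i* k)) < e.
  apply: cov => x _.
  have /contCP/(_ (e / 2)) := cf (x +i* k); rewrite divr_gt0// => /(_ isT)[d d0 H].
  have d2 : 0 < d / 2 by rewrite divr_gt0.
  exists (ball x (d / 2), ball k (d / 2)).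
    by split => /=; exact: nbhsx_ballx.
  move=> [x' y] /= [h1 h2] _.
  have n1 : normc ((x' +i* y) - (x +i* k)) < d.
    apply: le_lt_trans (normc_le_ReIm _) _ => /=.
    by move: h1 h2; rewrite /ball/= !(distrC _ x') !(distrC _ y); lra.
  have n2 : normc ((x' +i* k) - (x +i* k)) < d.
    apply: le_lt_trans (normc_le_ReIm _) _ => /=.
    by move: h1; rewrite /ball/= (distrC _ x') subrr normr0; lra.
  have := H _ n1; have := H _ n2.
  have := normc_triangleB (f (x' +i* y) - f (x +i* k)) (f (x' +i* k) - f (x +i* k)).
  by rewrite opprB addrA subrK; lra.
move=> /nbhs_normP[d d0 H]; exists d => // x y hx hy.
by apply: (H y _ x); rewrite /= ?in_itv//= distrC.
Qed.

(** The long sides nearly cancel by uniform continuity along the segment at height [k]; the vertical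
    sides are short and carry bounded values. *)
Lemma thin_rectint f a b k e : contCC f -> a <= b -> 0 < e ->
  exists2 d, 0 < d & forall y1 y2, y1 <= y2 -> `|y1 - k| < d -> `|y2 - k| < d ->
    normc (rectint f a b y1 y2) <= e.
Proof.
move=> cf ab e0.
pose K := normc (f (a +i* k)) + normc (f (b +i* k)) + 1.
have K0 : 0 < K by rewrite ltr_wpDl// addr_ge0// normc_ge0.
(* Having [e1] at most 1 makes [K] a bound on both vertical sides; the second entry keeps the long
   sides, at most [4 * e1 * (b - a)], below [e / 2]. *)
pose e1 := Num.min 1 (e / (8 * (b - a) + 8)).
have D0 : 0 < 8 * (b - a) + 8 by lra.
have e10 : 0 < e1 by rewrite lt_min ltr01 divr_gt0.
have e11 : e1 <= 1 by rewrite ge_min lexx.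
have e12 : e1 * (8 * (b - a) + 8) <= e.
  by rewrite -ler_pdivlMr// ge_min lexx orbT.
have [d d0 H] := uniform_on_segment a b k cf e10.
exists (Num.min d (e / (16 * K))); first by rewrite lt_min d0 divr_gt0// mulr_gt0.
move=> y1 y2 y12; rewrite !lt_min => /andP[h1 h1'] /andP[h2 h2'].
have yy : 4 * K * (y2 - y1) <= e / 2.
  have : y2 - y1 <= 2 * (e / (16 * K)).
    by move: h1' h2'; rewrite !ltr_norml => /andP[? ?] /andP[? ?]; lra.
  move=> /(ler_wpM2l (x := 4 * K)) hh; apply: le_trans (hh _) _; first by lra.
  by have -> : 4 * K * (2 * (e / (16 * K))) = e / 2 by field; exact: lt0r_neq0.
have hs : normc (cint (fun x => f (x +i* y1)) a b - cint (fun x => f (x +i* y2)) a b)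
    <= 2 * (2 * e1) * (b - a).
  rewrite -cintB//; [|exact: contCC_h..].
  apply: (cint_bound _ ab).
    by move=> t; apply: cvgB; [exact: (contCC_h (y := y1) cf)|exact: (contCC_h (y := y2) cf)].
  move=> t ht; have := H t y1 ht h1; have := H t y2 ht h2.
  have := normc_triangleB (f (t +i* y1) - f (t +i* k)) (f (t +i* y2) - f (t +i* k)).
  by rewrite opprB addrA subrK; lra.
have side x : x = a \/ x = b -> normc (cint (fun y => f (x +i* y)) y1 y2) <= 2 * K * (y2 - y1).
  move=> hx; apply: (cint_bound (contCC_v (x := x) cf) y12) => y hy.
  have hy' : `|y - k| < d.
    by move: h1 h2; rewrite !ltr_norml => /andP[? ?] /andP[? ?]; lra.
  have hxx : a <= x <= b by case: hx => ->; lra.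
  have := H x y hxx hy'; have := normc_triangle (f (x +i* y) - f (x +i* k)) (f (x +i* k)).
  rewrite subrK /K; have := normc_ge0 (f (a +i* k)); have := normc_ge0 (f (b +i* k)).
  by case: hx => ->; lra.
rewrite /rectint; apply: le_trans (normc_triangle _ _) _; rewrite normc_ii.
have := normc_triangleB (cint (fun y => f (b +i* y)) y1 y2) (cint (fun y => f (a +i* y)) y1 y2).
have := side a (or_introl erefl); have := side b (or_intror erefl).
by have := e12; rewrite mulrDr => e12'; lra.
Qed.

(** A strip around the exceptional line is cut out, clipped to the rectangle. Above and below it
    Goursat applies, and the strip contributes arbitrarily little. *)
Lemma cauchy_rect_line f a b c d k : contCC f -> a <= b -> c <= d ->
  (forall x y, a <= x <= b -> c <= y <= d -> y != k -> exists l, HasD f (x +i* y) l) ->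
  rectint f a b c d = 0.
Proof.
move=> cf ab cd h.
have deg y : rectint f a b y y = 0.
  by have := rectint_chasles_v f a b y y y; move=> /eqP; rewrite -subr_eq0 addrK => /eqP.
have off y1 y2 : c <= y1 -> y1 <= y2 -> y2 <= d -> (y2 < k \/ k < y1) ->
    rectint f a b y1 y2 = 0.
  move=> h1 h2 h3 h4; apply: cauchy_rect => // x y hx hy; left; apply: h => //; first by lra.
  by apply/eqP => yk; move: hy h4; rewrite yk => /andP[? ?] [?|?]; lra.
have [kc|kc] := ltP k c; first by apply: off => //; right.
have [dk|dk] := ltP d k; first by apply: off => //; left.
apply/eqP; rewrite -normc_eq0; apply/eqP/le_anti; rewrite normc_ge0 andbT.
apply/ler_addgt0Pr => e e0; rewrite add0r.
have [r r0 H] := thin_rectint k cf ab e0.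
pose y1 := Num.max c (k - r / 2); pose y2 := Num.min d (k + r / 2).
have cy1 : c <= y1 by rewrite le_max lexx.
have y2d : y2 <= d by rewrite ge_min lexx.
have y1k : y1 <= k by rewrite ge_max kc/=; lra.
have ky2 : k <= y2 by rewrite le_min dk/=; lra.
have y1r : k - r / 2 <= y1 by rewrite le_max lexx orbT.
have y2r : y2 <= k + r / 2 by rewrite ge_min lexx orbT.
rewrite -(rectint_chasles_v f a b c y1 d) -(rectint_chasles_v f a b y1 y2 d).
have -> : rectint f a b c y1 = 0.
  rewrite /y1; have [lt|_] := ltP c (k - r / 2); last exact: deg.
  by apply: off; [exact: lexx|exact: ltW|lra|left; lra].
have -> : rectint f a b y2 d = 0.
  rewrite /y2; have [_|le] := ltP d (k + r / 2); first exact: deg.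
  by apply: off; [lra|exact: le|exact: lexx|right; lra].
rewrite add0r addr0; apply: H; first by lra.
- by rewrite ltr_norml; lra.
- by rewrite ltr_norml; lra.
Qed.

Lemma normc_le z w : `|Re z| <= `|Re w| -> `|Im z| <= `|Im w| -> normc z <= normc w.
Proof.
move=> h1 h2; rewrite -(ler_pXn2r (n:=2))// ?nnegrE ?normc_ge0// !normc_sqr.
rewrite -(real_normK (num_real (Re z))) -(real_normK (num_real (Im z))).
rewrite -(real_normK (num_real (Re w))) -(real_normK (num_real (Im w))).
by apply: lerD; rewrite ler_pXn2r ?nnegrE.
Qed.

Lemma cint_approx (g : R -> C) (l : C) a b K : contRC g ->
  (forall t, Num.min a b <= t <= Num.max a b -> normc (g t - l) <= K) ->
  normc (cint g a b - l * (b - a)%:C) <= 2 * K * `|b - a|.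
Proof.
move=> cg; wlog ab : a b / a <= b.
  move=> hw; case/orP: (le_total a b) => [|ba]; first exact: hw.
  rewrite minC maxC distrC => /(hw _ _ ba).
  have -> : cint g a b - l * (b - a)%:C = - (cint g b a - l * (a - b)%:C).
    by rewrite (cintN g b a) !rmorphB; ring.
  by rewrite normcN.
rewrite (min_idPl ab) (max_idPr ab) => h.
have cl : contRC (fun=> l) by move=> t; exact: cvg_cst.
have cgl : contRC (fun t => g t - l) by move=> t; exact: (cvgB (cg t) (cl t)).
rewrite -cint_cst -(cintB cg cl ab) ger0_norm ?subr_ge0//.
exact: (cint_bound cgl ab h).
Qed.

(** Morera's construction: [F z] integrates [f] from [z0] along a horizontal and then a vertical
    segment. *)
Lemma primitive_of_cauchy f z0 r : contCC f ->
  (forall x1 x2 y1 y2, x1 <= x2 -> y1 <= y2 ->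
     `|x1 - Re z0| < r -> `|x2 - Re z0| < r ->
     `|y1 - Im z0| < r -> `|y2 - Im z0| < r -> rectint f x1 x2 y1 y2 = 0) ->
  exists F, forall z, `|Re z - Re z0| < r -> `|Im z - Im z0| < r -> HasD F z (f z).
Proof.
move=> cf h.
have H x1 x2 y1 y2 : `|x1 - Re z0| < r -> `|x2 - Re z0| < r ->
     `|y1 - Im z0| < r -> `|y2 - Im z0| < r -> rectint f x1 x2 y1 y2 = 0.
  move=> h1 h2 h3 h4.
  have [x12|/ltW x21] := leP x1 x2; have [y12|/ltW y21] := leP y1 y2.
  - exact: h.
  - by rewrite rectintN_v h// oppr0.
  - by rewrite rectintN_h h// oppr0.
  - by rewrite rectintN_h rectintN_v h// !oppr0.
pose F z := cint (fun x => f (x +i* Im z0)) (Re z0) (Re z) +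
            (0 +i* 1) * cint (fun y => f (Re z +i* y)) (Im z0) (Im z).
exists F => z hx hy e e0.
(* Each of the two legs of the increment costs [2 * (e / 4)] times its length, and each length is at
   most [normc (w - z)]. *)
have e4 : 0 < e / 4 by rewrite divr_gt0.
have /contCP /(_ _ e4)[d d0 D] := cf z.
pose r1 := r - `|Re z - Re z0|; pose r2 := r - `|Im z - Im z0|.
have r0 : 0 < r by apply: le_lt_trans hx; exact: normr_ge0.
exists (Num.min d (Num.min r1 r2)); first by rewrite !lt_min d0 !subr_gt0 hx.
move=> w; rewrite !lt_min => /and3P[wd wr1 wr2].
have nR := normc_Re (w - z); have nI := normc_Im (w - z).
rewrite ReD ReN in nR; rewrite ImD ImN in nI.
have wx : `|Re w - Re z0| < r.
  have := ler_normD (Re w - Re z) (Re z - Re z0); rewrite addrA subrK.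
  by move: wr1; rewrite /r1; lra.
have wy : `|Im w - Im z0| < r.
  have := ler_normD (Im w - Im z) (Im z - Im z0); rewrite addrA subrK.
  by move: wr2; rewrite /r2; lra.
have z0r (s : R) : `|s - s| < r by rewrite subrr normr0.
(* The vanishing integral over the rectangle between the heights [Im z0] and [Im z] moves the
   horizontal leg to height [Im z], so that both legs stay near [z]. *)
have E1 : F w - F z = cint (fun x => f (x +i* Im z)) (Re z) (Re w) +
    (0 +i* 1) * cint (fun y => f (Re w +i* y)) (Im z) (Im w).
  have := H (Re z) (Re w) (Im z0) (Im z) hx wx (z0r _) hy.
  rewrite /rectint /F -(cint_chasles _ (Re z0) (Re z) (Re w)).
  rewrite -(cint_chasles (fun y => f (Re w +i* y)) (Im z0) (Im z) (Im w)).
  move=> /eqP; rewrite -addrA addr_eq0 => /eqP Q.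
  move: Q; set A := cint _ _ _; set B := cint _ _ _; set D' := cint _ _ _; set E' := cint _ _ _.
  by move=> Q; rewrite (_ : A = B - (0 +i* 1) * (D' - E')); [ring|rewrite -[A](addrK 0) Q; ring].
have E2 : f z * (w - z) = f z * (Re w - Re z)%:C + (0 +i* 1) * (f z * (Im w - Im z)%:C).
  rewrite {1}(complexE (w - z)) ReD ReN ImD ImN complexiE; ring.
rewrite E1 E2.
have A1 := @cint_approx (fun x => f (x +i* Im z)) (f z) (Re z) (Re w) (e / 4) (contCC_h (y := Im z) cf).
have A2 := @cint_approx (fun y => f (Re w +i* y)) (f z) (Im z) (Im w) (e / 4) (contCC_v (x := Re w) cf).
have B1 : normc (cint (fun x => f (x +i* Im z)) (Re z) (Re w) - f z * (Re w - Re z)%:C)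
    <= 2 * (e / 4) * `|Re w - Re z|.
  apply: A1 => t ht; apply/ltW/D; apply: le_lt_trans wd; apply: normc_le => /=.
    rewrite !ReD !ReN /=; move: ht; case: (leP (Re z) (Re w)) => hh /andP[? ?].
      by rewrite !ger0_norm; lra.
    by rewrite !ler0_norm; lra.
  by rewrite ImD ImN /= subrr normr0.
have B2 : normc (cint (fun y => f (Re w +i* y)) (Im z) (Im w) - f z * (Im w - Im z)%:C)
    <= 2 * (e / 4) * `|Im w - Im z|.
  apply: A2 => t ht; apply/ltW/D; apply: le_lt_trans wd; apply: normc_le => /=.
    by rewrite !ReD !ReN.
  rewrite !ImD !ImN /=; move: ht; case: (leP (Im z) (Im w)) => hh /andP[? ?].
    by rewrite !ger0_norm; lra.
  by rewrite !ler0_norm; lra.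
move: B1 B2; set A := cint _ _ _; set B := cint _ _ _ => B1 B2.
have -> : A + (0 +i* 1) * B - (f z * (Re w - Re z)%:C + (0 +i* 1) * (f z * (Im w - Im z)%:C))
  = (A - f z * (Re w - Re z)%:C) + (0 +i* 1) * (B - f z * (Im w - Im z)%:C) by ring.
apply: le_trans (normc_triangle _ _) _; rewrite normc_ii.
have : e * `|Re w - Re z| <= e * normc (w - z) by rewrite ler_wpM2l// ltW.
have : e * `|Im w - Im z| <= e * normc (w - z) by rewrite ler_wpM2l// ltW.
lra.
Qed.

End LineRemoval.

(** * Local primitives and removability of circles *)

Section LocalPrimitive.
Variable R : realType.
Notation C := R[i].
Notation Re := (@complex.Re R).
Notation Im := (@complex.Im R).
Notation II := (0 +i* 1 : C).
Implicit Types (f g h : C -> C) (r d k : R) (z w l c : C).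

Lemma HasD_div f g z l (k : C) : HasD f z l -> HasD g z k -> g z != 0 ->
  HasD (fun w => f w / g w) z ((l * g z - f z * k) / g z ^+ 2).
Proof.
move=> hf hg gz; have := HasD_M hf (HasD_V hg gz).
by congr (HasD _ _ _); field.
Qed.

Lemma cont_near f g z d : 0 < d -> (forall w, normc (w - z) < d -> f w = g w) ->
  {for z, continuous f} -> {for z, continuous g}.
Proof.
move=> d0 fg /contCP cf; apply/contCP => e e0; have [d' d'0 H] := cf e e0.
exists (Num.min d d') => [|w]; first by rewrite lt_min d0.
rewrite lt_min => /andP[h1 h2]; rewrite -!fg//; first exact: H.
by rewrite subrr normc0.
Qed.

Lemma normc_in_ball z w v r : normc (w - z) < r -> normc (v - w) < r - normc (w - z) ->
  normc (v - z) < r.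
Proof.
move=> _ h; have := normc_triangle (v - w) (w - z); rewrite addrA subrK; lra.
Qed.

Definition clamp (s x : R) : R := Num.max (- s) (Num.min s x).

Lemma clamp_lip s x y : `|clamp s x - clamp s y| <= `|x - y|.
Proof.
have maxl (a u v : R) : `|Num.max a u - Num.max a v| <= `|u - v|.
  have := ler_norm (u - v); have := ler_norm (v - u); rewrite (distrC v).
  by rewrite ler_norml; case: (leP a u) => ?; case: (leP a v) => ? ? ?; lra.
have minl (a u v : R) : `|Num.min a u - Num.min a v| <= `|u - v|.
  have := ler_norm (u - v); have := ler_norm (v - u); rewrite (distrC v).
  by rewrite ler_norml; case: (leP a u) => ?; case: (leP a v) => ? ? ?; lra.
exact: le_trans (maxl _ _ _) (minl _ _ _).
Qed.

Lemma clamp_id s x : `|x| < s -> clamp s x = x.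
Proof.
rewrite ltr_norml => /andP[h1 h2]; rewrite /clamp (min_idPr _) ?(ltW h2)//.
by rewrite (max_idPr _)// ltW.
Qed.

Lemma clamp_le s x : 0 <= s -> `|clamp s x| <= s.
Proof.
move=> s0; rewrite ler_norml /clamp le_max lexx/= ge_max ge_min lexx/= andbT; lra.
Qed.

(** The rectangle calculus asks for continuity on the whole plane. Composing with the coordinatewise
    retraction onto a square of half-side [r / 4], which lies in the disk of radius [r], supplies it
    without changing [f] near [z0]. *)
Lemma extend_cont f z0 r : 0 < r ->
  (forall w, normc (w - z0) < r -> {for w, continuous f}) ->
  exists2 g, contCC g & forall w, `|Re w - Re z0| < r / 4 ->
    `|Im w - Im z0| < r / 4 -> g w = f w.
Proof.
move=> r0 cf; have s0 : 0 <= r / 4 by lra.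
pose ret (w : C) : C := (Re z0 + clamp (r / 4) (Re w - Re z0)) +i*
                        (Im z0 + clamp (r / 4) (Im w - Im z0)).
exists (fun w => f (ret w)).
- move=> w; apply: (continuous_comp (f := ret) (g := f)).
  + apply: cont_complex; apply/contCRP => e e0; exists e => // v vw;
      rewrite opprD addrACA subrr add0r; apply: le_lt_trans (clamp_lip _ _ _) _;
      rewrite opprB addrA subrK.
      by rewrite -ReN -ReD; apply: le_lt_trans (normc_Re _) _.
    by rewrite -ImN -ImD; apply: le_lt_trans (normc_Im _) _.
  + apply: cf; apply: le_lt_trans (normc_le_ReIm _) _.
    rewrite ReD ReN ImD ImN /= !(addrC _ (clamp _ _)) !addrK.
    have := clamp_le (Re w - Re z0) s0; have := clamp_le (Im w - Im z0) s0; lra.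
- move=> w h1 h2; rewrite /ret !clamp_id// !(addrC _ (_ - _)) !subrK.
  by case: (w).
Qed.

Lemma local_primitive_line f z0 r k : 0 < r ->
  (forall w, normc (w - z0) < r -> {for w, continuous f}) ->
  (forall w, normc (w - z0) < r -> Im w != k -> exists l, HasD f w l) ->
  local_primitive f z0.
Proof.
move=> r0 cf hf; have [g cg gf] := extend_cont r0 cf.
have s0 : 0 < r / 4 by lra.
have hg w : `|Re w - Re z0| < r / 4 -> `|Im w - Im z0| < r / 4 -> Im w != k ->
    exists l, HasD g w l.
  move=> h1 h2 wk.
  have wr : normc (w - z0) < r.
    apply: le_lt_trans (normc_le_ReIm _) _; rewrite ReD ReN ImD ImN; lra.
  have [l hl] := hf _ wr wk; exists l.
  pose m := Num.min (r / 4 - `|Re w - Re z0|) (r / 4 - `|Im w - Im z0|).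
  have m0 : 0 < m by rewrite lt_min !subr_gt0 h1.
  apply: HasD_near m0 _ hl => v; rewrite lt_min => /andP[n1 n2]; rewrite gf//.
    have := normc_Re (v - w); rewrite ReD ReN.
    by have := ler_normD (Re v - Re w) (Re w - Re z0); rewrite addrA subrK; lra.
  have := normc_Im (v - w); rewrite ImD ImN.
  by have := ler_normD (Im v - Im w) (Im w - Im z0); rewrite addrA subrK; lra.
have [F hF] : exists F, forall z, `|Re z - Re z0| < r / 4 ->
    `|Im z - Im z0| < r / 4 -> HasD F z (g z).
  apply: primitive_of_cauchy => // x1 x2 y1 y2 x12 y12 hx1 hx2 hy1 hy2.
  apply: (cauchy_rect_line (k := k)) => // x y hx hy yk; apply: hg => //=.
    by move: hx1 hx2; rewrite !ltr_norml => /andP[? ?] /andP[? ?]; lra.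
  by move: hy1 hy2; rewrite !ltr_norml => /andP[? ?] /andP[? ?]; lra.
exists (r / 4) => //; exists F => w hw.
have h1 : `|Re w - Re z0| < r / 4.
  by rewrite -ReN -ReD; apply: le_lt_trans (normc_Re _) _.
have h2 : `|Im w - Im z0| < r / 4.
  by rewrite -ImN -ImD; apply: le_lt_trans (normc_Im _) _.
by rewrite -gf//; exact: hF.
Qed.

Lemma sqr_ii : II * II = -1.
Proof. by simpc; congr (_ +i* _); ring. Qed.

(* The Cayley map sends the real line to the circle, and f o phi multiplied by phi'
   has a primitive; composing that primitive with the inverse of phi gives one of f. *)
Lemma local_primitive_circle f z0 r c : 0 < r -> z0 != c ->
  (forall w, normc (w - z0) < r -> {for w, continuous f}) ->
  (forall w, normc (w - z0) < r -> normc (w - c) != normc (z0 - c) ->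
     exists l, HasD f w l) ->
  local_primitive f z0.
Proof.
move=> r0 z0c cf hf; pose zt := z0 - c.
have zt0 : zt != 0 by rewrite subr_eq0.
have two0 : (2 : C) != 0 by rewrite pnatr_eq0.
(* The quotient [num / den] sends 0 to 1 and the real line into the unit circle, so [phi] sends 0 to
   [z0] and the real line into the circle about [c] through [z0]. *)
pose den w := 1 - II * w; pose num w := 1 + II * w.
pose phi w := c + zt * (num w / den w).
pose dphi w := zt * (2 * II) / den w ^+ 2.
have Dlin (p q w : C) : HasD (fun v => p + q * v) w q.
  have := HasD_D (HasD_cst p w) (HasD_M (HasD_cst q w) (HasD_id w)).
  by congr (HasD _ _ _); ring.
have Dnum w : HasD num w II by exact: Dlin.
have Dden w : HasD den w (- II).
  rewrite (_ : den = fun v => 1 + (- II) * v); first exact: Dlin.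
  by apply/funext => v; rewrite /den mulNr.
have den0 w : normc w < 1 -> den w != 0.
  move=> w1; rewrite subr_eq0; apply: contraTneq w1 => h.
  by rewrite -(normc_ii w) -h normc1 ltxx.
have Dphi w : normc w < 1 -> HasD phi w (dphi w).
  move=> w1; have dw := den0 w w1.
  have := HasD_D (HasD_cst c w) (HasD_M (HasD_cst zt w) (HasD_div (Dnum w) (Dden w) dw)).
  congr (HasD _ _ _); rewrite /dphi /num; move: dw; rewrite /den => dw.
  by field.
have phi0 : phi 0 = z0.
  by rewrite /phi /num /den mulr0 addr0 subr0 divr1 mulr1 addrC subrK.
have Ddphi w : normc w < 1 -> exists l, HasD dphi w l.
  move=> w1; have dw := den0 w w1.
  have := HasD_div (HasD_cst (zt * (2 * II)) w) (HasD_M (Dden w) (Dden w)).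
  rewrite mulf_neq0// => /(_ isT) h; eexists; exact: h.
have /contCP /(_ r r0)[d d0 Hd] : {for 0, continuous phi}.
  by apply: (HasD_cont (l := dphi 0)); apply: Dphi; rewrite normc0.
pose r1 := Num.min d 1.
have r10 : 0 < r1 by rewrite lt_min d0 ltr01.
have r1P w : normc (w - 0) < r1 -> normc w < 1 /\ normc (phi w - z0) < r.
  by rewrite lt_min => /andP[/Hd h1 h2]; rewrite -phi0; split => //; rewrite -(subr0 w).
pose g w := f (phi w) * dphi w.
have [r2 r20 [G HG]] : local_primitive g 0.
  apply: (@local_primitive_line _ _ r1 0 r10) => w /r1P[w1 wr].
  - have [l hl] := Ddphi w w1.
    have c1 := HasD_cont (Dphi w w1); have c2 := HasD_cont hl.
    exact: (cvgM (continuous_comp c1 (cf _ wr)) c2).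
  - move=> Iw; have [l hl] : exists l, HasD f (phi w) l.
      apply: hf => //; have dw := den0 w w1.
      rewrite /phi (addrC c) addrK normcM -/zt.
      (* Landing on the circle means that [num w] and [den w] have equal moduli. The difference of
         their squared moduli is $-4\,\mathrm{Im}\,w$, so only real [w] do. *)
      rewrite -subr_eq0 -{2}(mulr1 (normc zt)) -mulrBr mulf_neq0 ?normc_eq0//.
      rewrite normcM normcV subr_eq0; apply: contra_neq Iw => E.
      have /eqP := E; rewrite eq_sym -(divff (x := normc (den w))) ?normc_eq0//.
      rewrite -subr_eq0 -mulrBl mulf_eq0 invr_eq0 normc_eq0 (negbTE dw) orbF subr_eq0.
      move=> /eqP E2; have := normc_sqr (den w); rewrite E2 normc_sqr.
      rewrite /den /num !(ReD, ReN, ImD, ImN, ReM, ImM) /=; nra.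
    have [k' hk] := Ddphi w w1.
    by eexists; exact: (HasD_M (HasD_comp (Dphi w w1) hl) hk).
pose den' z := z - c + zt.
(* The inverse of [phi], obtained by solving $(z-c)/\zeta=(1+iw)/(1-iw)$ for $w$, where
   $\zeta=z_0-c$. *)
pose psi z := - II * ((z - z0) / den' z).
have den'0 : den' z0 != 0.
  by rewrite /den' -/zt (_ : zt + zt = 2 * zt) ?mulf_neq0//; ring.
have Dz0 (p z : C) : HasD (fun v => v + p) z 1.
  by have := HasD_D (HasD_id z) (HasD_cst p z); rewrite addr0.
have Dden' z : HasD den' z 1.
  rewrite (_ : den' = fun v => v + (- c + zt)); first exact: Dz0.
  by apply/funext => v; rewrite /den' -addrA.
have Dpsi z : den' z != 0 -> HasD psi z (- II * (2 * zt / den' z ^+ 2)).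
  move=> dz.
  have := HasD_M (HasD_cst (- II) z) (HasD_div (Dz0 (- z0) z) (Dden' z) dz).
  congr (HasD _ _ _); rewrite mul0r add0r mul1r mulr1; congr (_ * (_ / _)).
  by rewrite /den' /zt; ring.
have psi0 : psi z0 = 0 by rewrite /psi subrr mul0r mulr0.
have /contCP /(_ r2 r20)[d2 d20 Hd2] : {for z0, continuous psi}.
  exact: HasD_cont (Dpsi _ den'0).
have /contCP /(_ (normc (den' z0))) := HasD_cont (Dden' z0).
rewrite normc_gt0 den'0 => /(_ isT)[d3 d30 Hd3].
exists (Num.min d2 d3); first by rewrite lt_min d20.
exists (fun z => G (psi z)) => z; rewrite lt_min => /andP[z1 z2].
have dz : den' z != 0.
  by have := Hd3 z z2; apply: contraTneq => ->; rewrite sub0r normcN ltxx.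
have hpsi : normc (psi z - 0) < r2 by rewrite -{1}psi0; exact: Hd2.
have := HasD_comp (Dpsi z dz) (HG _ hpsi); congr (HasD _ _ _).
have i2 : - (II * II) = 1 by rewrite sqr_ii opprK.
have i0 : II != 0 by rewrite eq_complex /= eqxx oner_eq0.
have zE : z - z0 = z - c - zt by rewrite /zt opprB addrA subrK.
have dE : den (psi z) = 2 * zt / den' z.
  have -> : den (psi z) = 1 - - (II * II) * ((z - z0) / den' z).
    by rewrite /den /psi; ring.
  by rewrite i2 zE; move: dz; rewrite /den' => dz; field.
have nE : num (psi z) = 2 * (z - c) / den' z.
  have -> : num (psi z) = 1 + - (II * II) * ((z - z0) / den' z).
    by rewrite /num /psi; ring.
  by rewrite i2 zE; move: dz; rewrite /den' => dz; field.
have pE : phi (psi z) = z.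
  by rewrite /phi dE nE; field; rewrite dz zt0.
rewrite /g pE /dphi dE.
have -> : f z * (zt * (2 * II) / (2 * zt / den' z) ^+ 2) *
          (- II * (2 * zt / den' z ^+ 2)) = - (II * II) * f z.
  by field; rewrite zt0 dz.
by rewrite i2 mul1r.
Qed.

(** Unlike [local_primitive], this condition is visibly stable under adding or multiplying by a
    holomorphic function, and it implies [local_primitive]. The circle passes through [z0], and
    [z0 != c] keeps it from degenerating; the line is any horizontal one, so that ordinary
    holomorphic functions qualify. *)
Definition holo_off_curve f z0 := exists2 r, 0 < r &
  (forall w, normc (w - z0) < r -> {for w, continuous f}) /\
  ((exists k, forall w, normc (w - z0) < r -> Im w != k -> exists l, HasD f w l) \/
   (exists2 c, z0 != c & forall w, normc (w - z0) < r ->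
      normc (w - c) != normc (z0 - c) -> exists l, HasD f w l)).

Lemma holo_off_curve_local_primitive f z : holo_off_curve f z -> local_primitive f z.
Proof.
move=> [r r0 [cf [[k hf]|[c zc hf]]]]; first exact: local_primitive_line r0 cf hf.
exact: local_primitive_circle r0 zc cf hf.
Qed.

Lemma holo_off_curve_near f g z d : 0 < d -> (forall w, normc (w - z) < d -> f w = g w) ->
  holo_off_curve f z -> holo_off_curve g z.
Proof.
move=> d0 fg [r r0 [cf hf]]; pose m := Num.min d r.
have m0 : 0 < m by rewrite lt_min d0.
have fgw w : normc (w - z) < m -> 0 < d - normc (w - z) /\
    forall v, normc (v - w) < d - normc (w - z) -> f v = g v.
  rewrite lt_min => /andP[wd _]; split; first by rewrite subr_gt0.
  by move=> v vw; apply: fg; exact: normc_in_ball wd vw.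
have mr w : normc (w - z) < m -> normc (w - z) < r.
  by rewrite lt_min => /andP[].
have key w : normc (w - z) < m -> (exists l, HasD f w l) -> exists l, HasD g w l.
  by move=> /fgw[w1 w2] [l hl]; exists l; exact: HasD_near w1 w2 hl.
exists m => //; split.
  by move=> w wm; have [w1 w2] := fgw w wm; exact: cont_near w1 w2 (cf _ (mr _ wm)).
case: hf => [[k hf]|[c zc hf]]; [left; exists k|right; exists c => //];
  by move=> w wm wk; apply: key => //; apply: hf => //; exact: mr.
Qed.

Lemma holo_off_curve_mul f h z r : 0 < r -> (forall w, normc (w - z) < r -> exists l, HasD h w l) ->
  holo_off_curve f z -> holo_off_curve (fun w => f w * h w) z.
Proof.
move=> r0 hh [r' r'0 [cf hf]]; pose m := Num.min r r'.
have m0 : 0 < m by rewrite lt_min r0.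
have mP w : normc (w - z) < m -> normc (w - z) < r /\ normc (w - z) < r'.
  by rewrite lt_min => /andP[].
have key w : normc (w - z) < m -> (exists l, HasD f w l) ->
    exists l, HasD (fun w => f w * h w) w l.
  by move=> /mP[/hh[k hk] _] [l hl]; eexists; exact: HasD_M hl hk.
exists m => //; split.
  by move=> w /mP[/hh[k /HasD_cont hk] /cf cw]; exact: (cvgM cw hk).
case: hf => [[k hf]|[c zc hf]]; [left; exists k|right; exists c => //];
  by move=> w wm wk; apply: key => //; apply: hf => //; have [] := mP _ wm.
Qed.

Lemma holo_off_curve_holo f z r : 0 < r -> (forall w, normc (w - z) < r -> exists l, HasD f w l) ->
  holo_off_curve f z.
Proof.
move=> r0 hf; exists r => //; split; first by move=> w /hf[l] /HasD_cont.
by left; exists 0 => w /hf.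
Qed.

End LocalPrimitive.

(** * Mean value property and maximum principle *)

Section ComplexExponential.
Variable R : realType.
Notation C := R[i].
Notation Re := (@complex.Re R).
Notation Im := (@complex.Im R).
Notation cj := (@conjc R).
Implicit Types (z w : C).

Lemma cexpD z w : cexp (z + w) = cexp z * cexp w.
Proof.
rewrite /cexp ReD ImD expRD cosD sinD rmorphM.
have -> : forall a b c d : R, (a * c - b * d) +i* (b * c + a * d) =
    (a +i* b) * (c +i* d) :> C.
  by move=> a b c d; simpc; congr (_ +i* _); rewrite addrC.
ring.
Qed.

Lemma cexp0 : cexp 0 = 1 :> C.
Proof. by rewrite /cexp /= expR0 cos0 sin0 mul1r. Qed.

Lemma normc_cexp z : normc (cexp z) = expR (Re z).
Proof.
rewrite /cexp normcM normc_real ger0_norm ?expR_ge0//.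
by rewrite /normc cos2Dsin2 sqrtr1 mulr1.
Qed.

Lemma cexp_neq0 z : cexp z != 0.
Proof. by rewrite -normc_eq0 normc_cexp gt_eqF ?expR_gt0. Qed.

Lemma cexp_conj z : cj (cexp z) = cexp (cj z).
Proof.
rewrite /cexp conjcM conjc_real ReJ ImJ cosN sinN; congr (_ * _).
Qed.

Lemma is_derive_eps (F : R -> R) (x l : R) : is_derive x 1 F l ->
  forall e : R, 0 < e -> exists2 d : R, 0 < d & forall y, `|y - x| < d ->
    `|F y - F x - l * (y - x)| <= e * `|y - x|.
Proof.
move=> [/cvg_ex[l' h] dl] e e0.
have ll : l' = l.
  by rewrite -dl; symmetry; apply: cvg_lim; [exact: norm_hausdorff|exact: h].
rewrite ll in h; have /cvgrPdist_le/(_ e e0) := h.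
rewrite near_withinE => /nbhs_normP[d d0 H]; exists d => // y hy.
have [->|yx] := eqVneq y x; first by rewrite !subrr mulr0 subr0 normr0 mulr0.
have yx0 : y - x != 0 by rewrite subr_eq0.
have := H (y - x); rewrite /= sub0r normrN => /(_ hy yx0).
rewrite /GRing.scale /= mulr1 subrK => hh.
have -> : F y - F x - l * (y - x) = - (l - (y - x)^-1 * (F y - F x)) * (y - x).
  by field.
by rewrite normrM normrN ler_wpM2r.
Qed.

Lemma HasD_cexp0 : HasD (@cexp R) 0 1.
Proof.
(* Real and imaginary parts are bounded below by [3 * (k * normc w)] and [5 * (k * normc w)], whence
   [e / 8]. The bound 1 on [k] controls [sin b] by [2 * |b|] and [expR a - 1] by [2 * normc w]. *)
move=> e e0; pose k := Num.min 1 (e / 8).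
have k0 : 0 < k by rewrite lt_min ltr01 divr_gt0.
have k1 : k <= 1 by rewrite ge_min lexx.
have k2 : k <= e / 8 by rewrite ge_min lexx orbT.
clearbody k.
have [d1 d10 H1] := is_derive_eps (is_derive_expR (0 : R)) k0.
have [d2 d20 H2] := is_derive_eps (is_derive_cos (0 : R)) k0.
have [d3 d30 H3] := is_derive_eps (is_derive_sin (0 : R)) k0.
exists (Num.min k (Num.min d1 (Num.min d2 d3))); first by rewrite !lt_min k0 d10 d20.
move=> w; rewrite subr0 !lt_min => /and4P[wk w1 w2 w3].
pose a := Re w; pose b := Im w.
have na : `|a| <= normc w by exact: normc_Re.
have nb : `|b| <= normc w by exact: normc_Im.
have := H1 a; have := H2 b; have := H3 b.
rewrite !subr0 expR0 cos0 sin0 oppr0 mul0r addr0 !subr0 !mul1r.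
move=> /(_ (le_lt_trans nb w3)) h3 /(_ (le_lt_trans nb w2)) h2.
move=> /(_ (le_lt_trans na w1)) h1; rewrite cexp0.
have nc : `|cos b| <= 1 by rewrite ler_norml cos_geN1 cos_le1.
have ns : `|sin b| <= 2 * `|b|.
  have := ler_normD (sin b - b) b; rewrite subrK.
  have : k * `|b| <= 1 * `|b| by rewrite ler_wpM2r.
  by lra.
have ne : `|expR a - 1| <= 2 * normc w.
  have := ler_normD (expR a - 1 - a) a; rewrite subrK.
  have : k * `|a| <= 1 * `|a| by rewrite ler_wpM2r.
  by lra.
have kN : k * normc w <= e / 8 * normc w by rewrite ler_wpM2r ?normc_ge0.
have ka : k * `|a| <= k * normc w by rewrite ler_wpM2l// ltW.
have kb : k * `|b| <= k * normc w by rewrite ler_wpM2l// ltW.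
apply: le_trans (normc_le_ReIm _) _.
have -> : Re (cexp w - 1 - w) = (expR a - 1 - a) * cos b + (1 + a) * (cos b - 1).
  by rewrite !ReD !ReN /cexp ReM /= -/a -/b; ring.
have -> : Im (cexp w - 1 - w) = (expR a - 1) * sin b + (sin b - b).
  by rewrite !ImD !ImN /cexp ImM /= -/a -/b; ring.
have n1 : `|(expR a - 1 - a) * cos b + (1 + a) * (cos b - 1)| <= 3 * (k * normc w).
  apply: le_trans (ler_normD _ _) _; rewrite !normrM.
  have p1 : `|expR a - 1 - a| * `|cos b| <= k * `|a| * 1 by exact: ler_pM.
  have p2 : `|1 + a| * `|cos b - 1| <= 2 * (k * `|b|).
    apply: ler_pM => //; have := ler_normD 1 a; rewrite normr1; lra.
  lra.
have n2 : `|(expR a - 1) * sin b + (sin b - b)| <= 5 * (k * normc w).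
  apply: le_trans (ler_normD _ _) _; rewrite normrM.
  have p1 : `|expR a - 1| * `|sin b| <= (2 * k) * (2 * normc w).
    apply: ler_pM => //; first by lra.
    by lra.
  lra.
lra.
Qed.

Lemma HasD_cexp z : HasD (@cexp R) z (cexp z).
Proof.
have hs : HasD (fun w => w + - z) z 1.
  by have := HasD_D (HasD_id z) (HasD_cst (- z) z); rewrite addr0.
have h0 : HasD (@cexp R) (z + - z) 1 by rewrite subrr; exact: HasD_cexp0.
have := HasD_M (HasD_cst (cexp z) z) (HasD_comp hs h0).
rewrite mul0r add0r !mulr1; congr (HasD _ _ _).
by apply/funext => w; rewrite -cexpD addrC subrK.
Qed.

End ComplexExponential.

(** * Means over circles and the maximum principle *)

Section MeanValue.
Variable R : realType.
Notation C := R[i].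
Notation Re := (@complex.Re R).
Notation Im := (@complex.Im R).
Notation cj := (@conjc R).
Implicit Types (f g h : C -> C) (r d k K x : R) (z w l c a : C).

(* The circle is the image of a vertical segment under v |-> z0 + exp v, and
   exp v times f(w)/(w - z0) is f(z0 + exp v). *)
Lemma circle_mean_value f z0 r x : contCC f ->
  (forall z, z != z0 -> normc (z - z0) < r ->
     local_primitive (fun w => f w / (w - z0)) z) ->
  expR x < r ->
  cint (fun t => f (z0 + cexp (x +i* t))) 0 (2 * pi) = f z0 * (2 * pi)%:C.
Proof.
move=> cf hf xr; pose g w := f (z0 + cexp w).
have Dz w : HasD (fun v => z0 + cexp v) w (cexp w).
  by have := HasD_D (HasD_cst z0 w) (HasD_cexp w); rewrite add0r.
have cg : contCC g by move=> w; exact: (continuous_comp (HasD_cont (Dz w)) (cf _)).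
have pi20 : 0 <= 2 * pi :> R by have := pi_ge0 R; lra.
pose V y := cint (fun t => g (y +i* t)) 0 (2 * pi).
(* The mean does not depend on the radius: in the rectangle $[y,x]\times[0,2\pi]$ the horizontal
   sides cancel by periodicity of the exponential, which leaves equal vertical integrals. *)
have VV y : y <= x -> V x = V y.
  move=> yx; have : rectint g y x 0 (2 * pi) = 0.
    apply: cauchy_rect => // s t /andP[_ sx] _; right.
    set w0 := s +i* t; pose z := z0 + cexp w0.
    have [||rho rho0 [G HG]] := hf z _ _.
    - by rewrite -subr_eq0 /z addrAC subrr add0r cexp_neq0.
    - rewrite /z addrAC subrr add0r normc_cexp /=.
      by apply: le_lt_trans xr; rewrite ler_expR.
    have /contCP/(_ rho rho0)[d d0 H] := HasD_cont (Dz w0).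
    exists d => //; exists (fun v => G (z0 + cexp v)) => v hv.
    have := HasD_comp (Dz v) (HG _ (H _ hv)); congr (HasD _ _ _).
    by rewrite addrAC subrr add0r divfK ?cexp_neq0.
  have E : (fun s => g (s +i* 0)) = (fun s => g (s +i* (2 * pi))).
    apply/funext => s; rewrite /g; congr (f (z0 + _)); rewrite /cexp /=.
    by rewrite cos0 sin0 mulr_natl cos2pi sin2pi.
  rewrite /rectint E subrr add0r => /eqP; rewrite mulf_eq0 => /orP[|].
    by rewrite eq_complex /= eqxx oner_eq0.
  by rewrite subr_eq0 => /eqP.
apply/eqP; rewrite -subr_eq0 -normc_eq0; apply/eqP/le_anti; rewrite normc_ge0 andbT.
apply/ler_addgt0Pr => e e0; rewrite add0r.
pose e1 := e / (4 * pi + 1).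
have D0 : 0 < 4 * pi + 1 :> R by have := pi_ge0 R; lra.
have e10 : 0 < e1 by rewrite divr_gt0.
have /contCP /(_ e1 e10)[d d0 H] := cf z0.
(* The radius [expR y] is small enough for [f] to be within [e1] of [f z0] on the whole circle. *)
pose y := Num.min x (ln (d / 2)).
have yx : y <= x by rewrite ge_min lexx.
have yd : expR y < d.
  have : expR y <= d / 2.
    by rewrite -[leRHS]lnK ?posrE ?divr_gt0// ler_expR ge_min lexx orbT.
  lra.
rewrite -/(V x) (VV y yx) -[X in _ * X%:C](subr0 (2 * pi)).
apply: le_trans (cint_approx (K := e1) (contCC_v (x := y) cg) _) _.
  move=> t _; apply/ltW; apply: H.
  by rewrite addrAC subrr add0r normc_cexp.
rewrite subr0 ger0_norm// (_ : _ * _ = e1 * (4 * pi)); last by ring.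
rewrite /e1 mulrAC ler_pdivrMr// ler_wpM2l ?ltW//.
have := pi_ge0 R; lra.
Qed.

Lemma holo_off_curve_D f h z r : 0 < r -> (forall w, normc (w - z) < r -> exists l, HasD h w l) ->
  holo_off_curve f z -> holo_off_curve (fun w => f w + h w) z.
Proof.
move=> r0 hh [r' r'0 [cf hf]]; pose m := Num.min r r'.
have m0 : 0 < m by rewrite lt_min r0.
have mP w : normc (w - z) < m -> normc (w - z) < r /\ normc (w - z) < r'.
  by rewrite lt_min => /andP[].
have key w : normc (w - z) < m -> (exists l, HasD f w l) ->
    exists l, HasD (fun w => f w + h w) w l.
  by move=> /mP[/hh[k hk] _] [l hl]; eexists; exact: HasD_D hl hk.
exists m => //; split.
  by move=> w /mP[/hh[k /HasD_cont hk] /cf cw]; exact: (cvgD cw hk).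
case: hf => [[k hf]|[c zc hf]]; [left; exists k|right; exists c => //];
  by move=> w wm wk; apply: key => //; apply: hf => //; have [] := mP _ wm.
Qed.

Lemma holo_off_curve_cont f z : holo_off_curve f z -> {for z, continuous f}.
Proof. by move=> [r r0 [cf _]]; apply: cf; rewrite subrr normc0. Qed.

(** [Re (f z0)] is the average of [Re f] over the circle, and a continuous average is attained at
    some angle, where the bound [k] applies. The factor 4 is the loss of radius in [extend_cont]. *)
Lemma Re_circle_average f z0 r x k :
  (forall z, normc (z - z0) < r -> holo_off_curve f z) -> 4 * expR x < r ->
  (forall t, Re (f (z0 + cexp (x +i* t))) <= k) -> Re (f z0) <= k.
Proof.
move=> hf xr hk; have r0 : 0 < r by apply: lt_trans xr; rewrite mulr_gt0 ?expR_gt0.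
have [g cg gf] := extend_cont r0 (fun w hw => holo_off_curve_cont (hf w hw)).
have gf' w : normc (w - z0) < r / 4 -> g w = f w.
  move=> hw; apply: gf; rewrite -?ReN -?ReD -?ImN -?ImD.
    exact: le_lt_trans (normc_Re _) _.
  exact: le_lt_trans (normc_Im _) _.
have gg z : normc (z - z0) < r / 4 -> holo_off_curve g z.
  move=> hz; apply: (holo_off_curve_near (f := f) (d := r / 4 - normc (z - z0))).
  - by rewrite subr_gt0.
  - by move=> w hw; rewrite gf'//; exact: normc_in_ball hz hw.
  - by apply: hf; lra.
have xr4 : expR x < r / 4 by lra.
have lp z : z != z0 -> normc (z - z0) < r / 4 ->
    local_primitive (fun w => g w / (w - z0)) z.
  move=> zz0 hz; apply: holo_off_curve_local_primitive.
  apply: (@holo_off_curve_mul _ g (fun w => (w - z0)^-1) z (normc (z - z0))).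
  - by rewrite normc_gt0 subr_eq0.
  - move=> w hw.
    have h0 : HasD (fun w => w + - z0) w 1.
      by have := HasD_D (HasD_id w) (HasD_cst (- z0) w); rewrite addr0.
    eexists; apply: (HasD_V h0); apply: contraTneq hw => /eqP.
    rewrite subr_eq0 => /eqP ->.
    by rewrite normc_distC ltxx.
  - exact: gg.
have := circle_mean_value cg lp xr4.
rewrite gf' ?subrr ?normc0; last by lra.
have pi0 := pi_gt0 R.
have cgt : contRC (fun t => g (z0 + cexp (x +i* t))).
  move=> t; apply: (continuous_comp (f := fun t => z0 + cexp (x +i* t)) (g := g)); last exact: cg.
  apply: (cvgD (cvg_cst _)).
  apply: (continuous_comp (f := fun t => x +i* t) (g := @cexp R)); last exact: HasD_cont (HasD_cexp _).
  by apply: contRC_complex; [exact: cvg_cst|exact: cvg_id].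
have cu := contRC_Re cgt.
have p2 : 0 <= 2 * pi :> R by lra.
have [s _] := mean_value p2 (fun t _ => antiderP cu t).
move=> E /(congr1 Re); rewrite ReM /= mulr0 !subr0 /rint E subr0.
have us : (Re \o (fun t => g (z0 + cexp (x +i* t)))) s <= k.
  rewrite /= gf' ?hk// addrAC subrr add0r normc_cexp //.
move=> /(mulIf _) <- //.
by rewrite lt0r_neq0//; lra.
Qed.

Definition cdisk a r : set C := [set z | normc (z - a) <= r].

Lemma compact_cdisk a r : compact (cdisk a r).
Proof.
pose phi (p : R * R) : C := p.1 +i* p.2.
have cphi : continuous phi.
  move=> p P /nbhsCP[e e0 H]; have e2 : 0 < e / 2 by rewrite divr_gt0.
  exists (ball p.1 (e / 2), ball p.2 (e / 2)); first by split; exact: nbhsx_ballx.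
  move=> [s t] /= [h1 h2]; apply: H; apply: le_lt_trans (normc_le_ReIm _) _ => /=.
  by move: h1 h2; rewrite /ball/= (distrC _ s) (distrC _ t); lra.
pose S := `[Re a - r, Re a + r]%classic `*` `[Im a - r, Im a + r]%classic.
have cS : compact (phi @` S).
  apply: continuous_compact; first exact: continuous_subspaceT.
  by apply: compact_setX; exact: segment_compact.
apply: (subclosed_compact _ cS).
- move=> z hz; rewrite /cdisk /=; rewrite leNgt; apply/negP => rz.
  have : nbhs z [set w | normc (w - z) < normc (z - a) - r].
    by apply/nbhsCP; exists (normc (z - a) - r) => //; rewrite subr_gt0.
  move=> /hz[w []]; rewrite /cdisk /= => w1 w2.
  have := normc_triangle (z - w) (w - a); rewrite addrA subrK (normc_distC z w); lra.
- move=> z hz; exists (Re z, Im z); last by rewrite /phi; case: (z).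
  have := normc_Re (z - a); have := normc_Im (z - a).
  rewrite ReD ReN ImD ImN !ler_norml => h1 h2; move: hz h1 h2; rewrite /cdisk /=.
  by move=> hz /andP[? ?] /andP[? ?]; split; rewrite /= in_itv/=; lra.
Qed.

Lemma max_on_cdisk (u : C -> R) a r : 0 <= r ->
  (forall z, normc (z - a) <= r -> {for z, continuous u}) ->
  exists2 p, normc (p - a) <= r & forall z, normc (z - a) <= r -> u z <= u p.
Proof.
move=> r0 cu.
have ne : cdisk a r !=set0 by exists a; rewrite /cdisk /= subrr normc0.
have cw : {within cdisk a r, continuous u}.
  by apply: continuous_in_subspaceT => z; rewrite inE => /cu.
have [p pA H] := compact_EVT_max ne (@compact_cdisk a r) cw.
exists p; first by move: pA; rewrite inE.
by move=> z hz; apply: H; rewrite inE.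
Qed.

(* At an interior maximum p of Re f + e |z - a|^2, the mean value property of
   f + 2 e conj(p - a) (z - p) gives a contradiction. *)
Theorem maximum_principle f a r k : 0 < r ->
  (forall z, normc (z - a) <= r -> {for z, continuous f}) ->
  (forall z, normc (z - a) < r -> holo_off_curve f z) ->
  (forall z, normc (z - a) = r -> Re (f z) <= k) ->
  forall z, normc (z - a) <= r -> Re (f z) <= k.
Proof.
move=> r0 cf hf hk z0 hz0; apply/ler_addgt0Pr => e' e'0.
(* Chosen so that the perturbation [e * normc (z - a) ^+ 2] stays below [e'] on the disk. *)
pose e := e' / (r ^+ 2 + 1).
have D0 : 0 < r ^+ 2 + 1 by rewrite ltr_wpDl// sqr_ge0.
have e0 : 0 < e by rewrite divr_gt0.
have er : e * r ^+ 2 <= e'.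
  by rewrite /e mulrAC ler_pdivrMr// ler_wpM2l ?ltW//; lra.
pose v z := Re (f z) + e * normc (z - a) ^+ 2.
have [|p hp H] := @max_on_cdisk v a r (ltW r0).
  move=> z /cf cz.
  have cza : {for z, continuous (fun z => z - a)} by exact: (cvgB cvg_id (cvg_cst _)).
  have c1 : {for z, continuous (fun z => Re (f z))}.
    exact: (continuous_comp cz (@cont_Re R _)).
  have c2 : {for z, continuous (fun z => normc (z - a))}.
    exact: (continuous_comp cza (@cont_normc R _)).
  exact: (cvgD c1 (cvgM (cvg_cst e) (cvgM c2 c2))).
have vz0 := H z0 hz0.
have vz0' : Re (f z0) <= v p.
  by apply: le_trans vz0; rewrite /v lerDl mulr_ge0 ?sqr_ge0// ltW.
have [pr|pr] := ltP (normc (p - a)) r; last first.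
  have pE : normc (p - a) = r by apply/le_anti; rewrite hp.
  by apply: le_trans vz0' _; rewrite /v pE; have := hk p pE; lra.
exfalso; pose q := p - a.
(* The real part of [h] is the linear part of [e * normc (z - a) ^+ 2] at [p]. Adding [h] to [f]
   leaves only the quadratic term [e * s2], of constant sign on circles about [p]. *)
pose h z := (2 * e)%:C * cj q * (z - p).
have Dh z : HasD h z ((2 * e)%:C * cj q).
  have hs : HasD (fun w => w + - p) z 1.
    by have := HasD_D (HasD_id z) (HasD_cst (- p) z); rewrite addr0.
  by have := HasD_M (HasD_cst ((2 * e)%:C * cj q) z) hs; rewrite mul0r add0r mulr1.
pose rho := r - normc (p - a).
have rho0 : 0 < rho by rewrite subr_gt0.
(* Radius [rho / 8] keeps the circle inside the disk and satisfies the condition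
   [4 * expR x < rho]. *)
pose x := ln (rho / 8).
have ex : expR x = rho / 8 by rewrite lnK// posrE divr_gt0.
pose s2 := (rho / 8) ^+ 2.
have : Re (f p + h p) <= Re (f p) - e * s2.
  apply: (@Re_circle_average (fun z => f z + h z) p rho x).
  - move=> z hz; apply: (@holo_off_curve_D _ _ _ 1) => //; first by move=> w _; eexists; exact: Dh.
    by apply: hf; apply: normc_in_ball pr hz.
  - by rewrite ex; lra.
  - move=> t; set c := cexp _.
    have nc : normc c ^+ 2 = s2 by rewrite normc_cexp /= ex.
    have hpc : normc (p + c - a) <= r.
      have := normc_triangle (p - a) c; rewrite addrAC normc_cexp /= ex.
      by move: rho0; rewrite /rho; lra.
    have := H _ hpc; rewrite /v.
    have -> : normc (p + c - a) ^+ 2 = normc q ^+ 2 + s2 + 2 * Re (cj q * c).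
      rewrite -nc (_ : p + c - a = q + c); last by rewrite /q addrAC.
      by rewrite !normc_sqr ReD ImD ReM ReJ ImJ; ring.
    have ReZ (s : R) w : Re (s%:C * w) = s * Re w by rewrite ReM /= mul0r subr0.
    rewrite ReD /h (addrC p c) addrK -mulrA ReZ -/q.
    by rewrite !mulrDr; lra.
rewrite ReD /h subrr mulr0 /= addr0.
have : 0 < e * s2 by rewrite mulr_gt0// exprn_gt0// divr_gt0.
lra.
Qed.

End MeanValue.

(** * Uniqueness theorems *)

Section Uniqueness.
Variable R : realType.
Notation C := R[i].
Notation Re := (@complex.Re R).
Notation Im := (@complex.Im R).
Notation cj := (@conjc R).
Implicit Types (f g h : C -> C) (r d k x s : R) (z w l c a : C).

(** Multiplying [f] by the conjugate of [f z] makes its value at [z] real, equal to the squared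
    modulus, so the principle for real parts applies. *)
Theorem maximum_modulus f a r k : 0 < r ->
  (forall z, normc (z - a) <= r -> {for z, continuous f}) ->
  (forall z, normc (z - a) < r -> holo_off_curve f z) ->
  (forall z, normc (z - a) = r -> normc (f z) <= k) ->
  forall z, normc (z - a) <= r -> normc (f z) <= k.
Proof.
move=> r0 cf hf hk z hz.
have [->|fz0] := eqVneq (f z) 0.
  rewrite normc0; have := hk (a + r%:C); rewrite addrAC subrr add0r normc_real (ger0_norm (ltW r0)).
  by move=> /(_ erefl); apply: le_trans; exact: normc_ge0.
pose c := cj (f z).
have nc : normc c = normc (f z) by rewrite normc_conj.
have : Re (f z * c) <= k * normc c.
  apply: (@maximum_principle _ (fun w => f w * c) a r _ r0 _ _ _ z hz).
  - by move=> w /cf cw; exact: (cvgM cw (cvg_cst c)).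
  - move=> w /hf; apply: (@holo_off_curve_mul _ _ _ _ 1) => // v _.
    by exists 0; exact: HasD_cst.
  - move=> w hw; apply: le_trans (ler_norm _) _; apply: le_trans (normc_Re _) _.
    by rewrite normcM ler_wpM2r ?normc_ge0// hk.
rewrite nc ReM ReJ ImJ mulrN opprK -!expr2 -normc_sqr expr2.
by rewrite ler_pM2r// normc_gt0.
Qed.

(** The maximum modulus on a disk containing [z], whose boundary lies where [f] is at most [e]. *)
Lemma holo_off_curve_decay_eq0 f : (forall z, holo_off_curve f z) ->
  (forall e : R, 0 < e -> exists r, forall z, r <= normc z -> normc (f z) <= e) ->
  forall z, f z = 0.
Proof.
move=> hf dec z; apply/eqP; rewrite -normc_eq0; apply/eqP/le_anti.
rewrite normc_ge0 andbT; apply/ler_addgt0Pr => e e0; rewrite add0r.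
have [r hr] := dec e e0; pose rho := `|r| + normc z + 1.
have rho0 : 0 < rho by rewrite ltr_wpDl// addr_ge0// normc_ge0.
apply: (@maximum_modulus f 0 rho e rho0).
- by move=> w _; exact: holo_off_curve_cont.
- by move=> w _.
- move=> w; rewrite subr0 => hw; apply: hr; rewrite hw /rho.
  by have := ler_norm r; have := normc_ge0 z; lra.
- by rewrite subr0 /rho; have := normr_ge0 r; lra.
Qed.

Lemma holo_off_curve0 f z d : 0 < d -> (forall w, normc (w - z) < d -> f w = 0) -> holo_off_curve f z.
Proof.
move=> d0 f0; apply: (@holo_off_curve_near _ (fun=> 0) f z d d0) => [w /f0//|].
by apply: (@holo_off_curve_holo _ _ _ 1) => // w _; exists 0; exact: HasD_cst.
Qed.

Lemma HasD_exprn z a n : exists l, HasD (fun w => (w - a) ^+ n) z l.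
Proof.
elim: n => [|n [l hl]]; first by exists 0; exact: HasD_cst.
have hs : HasD (fun w => w + - a) z 1.
  by have := HasD_D (HasD_id z) (HasD_cst (- a) z); rewrite addr0.
rewrite (_ : (fun w => (w - a) ^+ n.+1) = fun w => (w + - a) * (w - a) ^+ n).
  by eexists; exact: (HasD_M hs hl).
by apply/funext => w; rewrite exprS.
Qed.

(* If f vanishes near a, the maximum principle applies to f(z) / (z - a)^n for every n. *)
Lemma holo_off_curve_eq0_disk f a r d : 0 < d -> (forall w, normc (w - a) < d -> f w = 0) ->
  (forall z, normc (z - a) < r -> holo_off_curve f z) ->
  forall z, normc (z - a) < r -> f z = 0.
Proof.
move=> d0 f0 hf z hz.
(* A radius strictly between makes the ratio [normc (z - a) / r1] less than 1, so its powers tend to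
   0 while [K] stays fixed. *)
pose r1 := (normc (z - a) + r) / 2.
have z1 : normc (z - a) < r1 by rewrite /r1; lra.
have r1r : r1 < r by rewrite /r1; lra.
have r10 : 0 < r1 by apply: le_lt_trans z1; exact: normc_ge0.
have cf w : normc (w - a) <= r1 -> {for w, continuous f}.
  by move=> hw; apply/holo_off_curve_cont/hf; exact: le_lt_trans r1r.
have [|p _ hp] := @max_on_cdisk R (fun w => normc (f w)) a r1 (ltW r10).
  by move=> w /cf cw; exact: (continuous_comp cw (@cont_normc R _)).
pose K := normc (f p).
have bound n : normc (f z) <= K * (normc (z - a) / r1) ^+ n.
  have [za|za] := eqVneq z a.
    by rewrite za f0 ?subrr ?normc0 ?mul0r// mulr_ge0 ?exprn_ge0 ?normc_ge0.
  pose g w := f w * ((w - a) ^+ n)^-1.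
  have gd w : normc (w - a) < d -> g w = 0 by move=> /f0 E; rewrite /g E mul0r.
  have gg w : normc (w - a) < r -> holo_off_curve g w.
    move=> hw; have [wa|wa] := eqVneq w a.
      by apply: (holo_off_curve0 (d := d)) => // v; rewrite wa => /gd.
    apply: (@holo_off_curve_mul _ _ _ _ (normc (w - a))); last exact: hf.
      by rewrite normc_gt0 subr_eq0.
    move=> v hv; have [l hl] := HasD_exprn v a n.
    eexists; apply: (HasD_V hl); rewrite expf_neq0// subr_eq0.
    by apply: contraTneq hv => ->; rewrite normc_distC ltxx.
  have : normc (g z) <= K / r1 ^+ n.
    apply: (@maximum_modulus g a r1 _ r10 _ _ _ z (ltW z1)).
    - by move=> w hw; apply/holo_off_curve_cont/gg; exact: le_lt_trans r1r.
    - by move=> w hw; apply/gg; exact: lt_trans r1r.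
    - move=> w hw; rewrite /g normcM normcV normcX hw.
      apply: ler_wpM2r; first by rewrite invr_ge0 exprn_ge0// ltW.
      by apply: hp; rewrite hw.
  rewrite /g normcM normcV normcX ler_pdivrMr ?exprn_gt0 ?normc_gt0 ?subr_eq0//.
  have -> : K * (normc (z - a) / r1) ^+ n = K / r1 ^+ n * normc (z - a) ^+ n.
    by rewrite exprMn exprVn; ring.
  by [].
apply/eqP; rewrite -normc_eq0; apply/eqP/le_anti; rewrite normc_ge0 andbT.
apply/ler_addgt0Pr => e e0; rewrite add0r.
pose q := normc (z - a) / r1.
have q1 : `|q| < 1.
  have q0 : 0 <= q by rewrite divr_ge0 ?normc_ge0// ltW.
  by rewrite (ger0_norm q0) /q ltr_pdivrMr// mul1r.
have K1 : 0 < K + 1 by rewrite ltr_wpDl// normc_ge0.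
have /cvgrPdist_lt/(_ _ (divr_gt0 e0 K1)) := cvg_expr q1.
move=> [n _ /(_ n (leqnn _))] /=; rewrite sub0r normrN => qn.
apply: le_trans (bound n) _; apply: le_trans (ler_wpM2l (normc_ge0 _) (ler_norm _)) _.
rewrite ltr_pdivlMr// in qn; apply: le_trans _ (ltW qn).
by rewrite mulrC ler_wpM2l// lerDl.
Qed.

Lemma normc_lt_sqr z r : 0 <= r -> (normc z < r) = (Re z ^+ 2 + Im z ^+ 2 < r ^+ 2).
Proof. by move=> r0; rewrite -normc_sqr ltr_pXn2r ?nnegrE ?normc_ge0. Qed.

(** The condition [s ^+ 2 = 1] means that [s] is 1 or -1; the sign selects the upper or the lower
    half-plane, so one proof serves both. *)
Lemma half_plane_open s z w : s ^+ 2 = 1 -> normc (w - z) < `|Im z| ->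
  0 < s * Im z -> 0 < s * Im w.
Proof.
move=> s2 h sz; have ns : `|s| = 1.
  by apply/eqP; rewrite -(@eqrXn2 _ 2)// ?real_normK ?num_real ?s2 ?expr1n.
have : `|s * Im w - s * Im z| < `|s * Im z|.
  rewrite -mulrBr !normrM ns !mul1r; apply: le_lt_trans h.
  by rewrite -ImN -ImD; exact: normc_Im.
by rewrite (gtr0_norm sz) ltr_norml; lra.
Qed.

(* Extended by zero across the positive half-line, f vanishes on disks that
   reach into the other half-plane, hence on a quadrant; disks tangent to the
   real line with centre in this quadrant exhaust the half-plane. *)
Theorem half_plane_eq0 s f : s ^+ 2 = 1 ->
  (forall z, 0 < s * Im z -> holo_off_curve f z) ->
  (forall x, 0 < x -> exists2 r, 0 < r & forall w, normc (w - x%:C) < r ->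
     0 < s * Im w -> exists l, HasD f w l) ->
  (forall x, 0 < x -> forall e : R, 0 < e -> exists2 d, 0 < d &
     forall w, normc (w - x%:C) < d -> 0 < s * Im w -> normc (f w) < e) ->
  forall z, 0 < s * Im z -> f z = 0.
Proof.
move=> s2 hgood hol lim.
have ns : `|s| = 1.
  by apply/eqP; rewrite -(@eqrXn2 _ 2)// ?real_normK ?num_real ?s2 ?expr1n.
have near_side z w : normc (w - z) < `|Im z| -> 0 < s * Im z -> 0 < s * Im w.
  exact: half_plane_open.
have near_sideN z w : normc (w - z) < `|Im z| -> s * Im z < 0 -> s * Im w < 0.
  have sN2 : (- s) ^+ 2 = 1 by rewrite sqrrN.
  by move=> h sz; have := half_plane_open sN2 h; rewrite !mulNr !oppr_gt0; exact.
pose F w := if 0 < s * Im w then f w else 0.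
have ImP z : s * Im z != 0 -> 0 < `|Im z|.
  by move=> h; rewrite normr_gt0; apply: contraNneq h => ->; rewrite mulr0.
have gpos z : 0 < s * Im z -> holo_off_curve F z.
  move=> sz; apply: (holo_off_curve_near (d := `|Im z|)) (hgood z sz); first by apply: ImP; rewrite gt_eqF.
  by move=> w hw; rewrite /F (near_side _ _ hw sz).
have Fneg z : s * Im z < 0 -> forall w, normc (w - z) < `|Im z| -> F w = 0.
  by move=> sz w hw; rewrite /F ltNge ltW//; exact: near_sideN hw sz.
have gneg z : s * Im z < 0 -> holo_off_curve F z.
  move=> sz; apply: (holo_off_curve0 (d := `|Im z|)); first by apply: ImP; rewrite lt_eqF.
  exact: Fneg.
have gre z : s * Im z = 0 -> 0 < Re z -> holo_off_curve F z.
  move=> sz rz.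
  have iz : Im z = 0.
    by apply/eqP; rewrite -normr_eq0 -[`|_|]mul1r -ns -normrM sz normr0.
  have zE : z = (Re z)%:C by apply: eq_ReIm.
  have [r r0 hr] := hol _ rz; rewrite -zE in hr.
  have dF w : normc (w - z) < r -> s * Im w != 0 -> exists l, HasD F w l.
    move=> hw; rewrite neq_lt => /orP[sw|sw].
      exists 0; apply: (HasD_near (f := fun=> 0) (d := `|Im w|)); last exact: HasD_cst.
        by apply: ImP; rewrite lt_eqF.
      by move=> v hv; rewrite (Fneg w sw).
    have [l hl] := hr w hw sw; exists l.
    apply: HasD_near hl; first by apply: (ImP w); rewrite gt_eqF.
    by move=> v hv; rewrite /F (near_side _ _ hv sw).
  exists (Num.min r (Re z)); first by rewrite lt_min r0.
  split.
    move=> w; rewrite lt_min => /andP[wr wz].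
    have [sw|sw] := eqVneq (s * Im w) 0; last first.
      by have [l /HasD_cont] := dF w wr sw.
    have rw : 0 < Re w.
      have := normc_Re (w - z); rewrite ReD ReN => h.
      have := le_lt_trans h wz; rewrite ltr_norml; lra.
    have iw : Im w = 0.
      by apply/eqP; rewrite -normr_eq0 -[`|_|]mul1r -ns -normrM sw normr0.
    have wE : w = (Re w)%:C by apply: eq_ReIm.
    apply/contCP => e e0; have [d d0 hd] := lim _ rw e e0; exists d => // v hv.
    have -> : F w = 0 by rewrite /F sw ltxx.
    by rewrite subr0 /F; case: ifP => [sv|_]; [apply: hd; rewrite -?wE|rewrite normc0].
  left; exists 0 => w; rewrite lt_min => /andP[wr _] iw; apply: dF => //.
  by rewrite mulf_neq0// -normr_eq0 ns oner_eq0.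
have sIm (p q : R) : s * (s * p) = p by rewrite mulrA -expr2 s2 mul1r.
have quadrant z : 0 < Re z -> F z = 0.
  move=> rz; have [sz|sz] := ltP 0 (s * Im z); last by rewrite /F ltNge sz.
  (* The disk of centre $q-is$ and radius $\sqrt{q^2+1}$ has 0 on its boundary, so all its real
     points are positive and the negative half-line is never met. Around its centre [F] is 0. It
     contains [z] as soon as [2 * q * Re z] exceeds [Re z ^+ 2 + y ^+ 2 + 2 * y]; the final 1 in [q]
     makes this strict. *)
  pose y := s * Im z; pose q := (Re z ^+ 2 + y ^+ 2 + 2 * y + 1) / (2 * Re z).
  have y0 : 0 < y by [].
  have q0 : 0 < q.
    by rewrite divr_gt0 ?mulr_gt0//; have := sqr_ge0 (Re z); have := sqr_ge0 y; lra.
  have qE : 2 * q * Re z = Re z ^+ 2 + y ^+ 2 + 2 * y + 1.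
    by rewrite /q; field; exact: lt0r_neq0.
  pose rho := Num.sqrt (q ^+ 2 + 1).
  have rho2 : rho ^+ 2 = q ^+ 2 + 1 by rewrite sqr_sqrtr// addr_ge0 ?sqr_ge0.
  have rho0 : 0 <= rho by exact: sqrtr_ge0.
  pose a := q +i* (- s) : C.
  have sq w : Im (w - a) ^+ 2 = (s * Im w + 1) ^+ 2.
    rewrite ImD ImN /= opprK.
    have -> : (Im w + s) ^+ 2 = s ^+ 2 * (Im w + s) ^+ 2 by rewrite s2 mul1r.
    by rewrite -exprMn mulrDr -expr2 s2.
  have rq w : Re (w - a) = Re w - q by rewrite ReD ReN.
  apply: (@holo_off_curve_eq0_disk F a rho 1) => //.
  - have sa : s * Im a = -1 by rewrite /= mulrN -expr2 s2.
    move=> w hw; apply: (Fneg a); first by rewrite sa ltrN10.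
    by rewrite /= normrN ns.
  - move=> w; rewrite normc_lt_sqr// rho2 sq rq => hw.
    have [sw|sw|sw] := ltgtP (s * Im w) 0; [exact: gneg|exact: gpos|].
    apply: gre => //; move: hw; rewrite sw add0r expr1n => hw.
    by have := sqr_ge0 (Re w); nra.
  - rewrite normc_lt_sqr// rho2 sq rq -/y; nra.
move=> z sz; have -> : f z = F z by rewrite /F sz.
pose y := s * Im z; have y0 : 0 < y by [].
(* The disk of centre $1+isT$ and radius $T$ touches the real line at 1. The unit disk about its
   centre lies in the region [0 < Re w] just treated, and [T] is large enough for the tangent disk
   to contain [z]. *)
pose T := ((Re z - 1) ^+ 2 + y ^+ 2 + 1) / (2 * y).
have T0 : 0 < T.
  apply: divr_gt0; last by apply: mulr_gt0.
  by apply: ltr_wpDl => //; apply: addr_ge0; exact: sqr_ge0.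
have TE : 2 * T * y = (Re z - 1) ^+ 2 + y ^+ 2 + 1.
  by rewrite /T; field; exact: lt0r_neq0.
pose a := 1 +i* (s * T) : C.
have sq w : Im (w - a) ^+ 2 = (s * Im w - T) ^+ 2.
  rewrite ImD ImN /=.
  have -> : (Im w - s * T) ^+ 2 = s ^+ 2 * (Im w - s * T) ^+ 2 by rewrite s2 mul1r.
  by rewrite -exprMn mulrBr sIm.
have rq w : Re (w - a) = Re w - 1 by rewrite ReD ReN.
apply: (@holo_off_curve_eq0_disk F a T 1) => //.
- move=> w hw; apply: quadrant.
  have := le_lt_trans (normc_Re _) hw; rewrite rq ltr_norml; lra.
- move=> w; rewrite (normc_lt_sqr _ (ltW T0)) sq rq => hw.
  by apply: gpos; have := sqr_ge0 (Re w - 1); nra.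
- rewrite (normc_lt_sqr _ (ltW T0)) sq rq -/y; nra.
Qed.

End Uniqueness.

(** * Symmetry of the jump matrices *)

Section Jumps.
Variable R : realType.
Notation C := R[i].
Notation Re := (@complex.Re R).
Notation Im := (@complex.Im R).
Notation cj := (@conjc R).
Implicit Types (z w l c a : C).

Lemma conj_numE z : Num.conj z = cj z. Proof. by []. Qed.

Lemma mulmx2 p (A : 'M[C]_(p, 2)) (B : 'M[C]_2) i j :
  (A *m B) i j = A i 0 * B 0 j + A i 1 * B 1 j.
Proof.
rewrite mxE !big_ord_recl big_ord0 addr0.
by rewrite (_ : lift ord0 ord0 = 1)//; exact: val_inj.
Qed.

Lemma ord2E (k : 'I_2) : k = 0 \/ k = 1.
Proof. by case: k => -[|[|//]] h; [left|right]; exact: val_inj. Qed.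

Lemma conjK z : cj (cj z) = z. Proof. exact: conjcK. Qed.

Lemma conjV z : cj z^-1 = (cj z)^-1. Proof. exact: conjc_inv. Qed.

Lemma conjX z n : cj (z ^+ n) = cj z ^+ n. Proof. exact: rmorphXn. Qed.

Lemma phase_conj x t z :
  cj (2 * 'i * Theta x t z) = - (2 * 'i * Theta x t (cj z)).
Proof.
have ci : cj ('i%R : C) = - 'i%R by rewrite -conj_numE; exact: conjCi.
have c2 : cj (2 : C) = 2 by exact: (conjc_nat _ 2).
have c4 : cj (4 : C) = 4 by exact: (conjc_nat _ 4).
rewrite /Theta conjcM [cj (2 * _)]conjcM c2 ci mulrN mulNr; congr (- (_ * _)).
by rewrite conjcD !conjcM conjcB conjcD !conjV !conjc_real c4.
Qed.

Lemma cexp_phase_conj x t z :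
  cj (cexp (- (2 * 'i * Theta x t (cj z)))) = cexp (2 * 'i * Theta x t z).
Proof. by rewrite cexp_conj -phase_conj conjK. Qed.

Lemma conj_cexp_phase x t z :
  cj (cexp (2 * 'i * Theta x t (cj z))) = cexp (- (2 * 'i * Theta x t z)).
Proof. by rewrite cexp_conj phase_conj conjK. Qed.

Definition dsig (z : C) (k : 'I_2) : C := if k == 0 then 1 else z.

(* J(z) diag(1, z) = diag(1, z) J'(conj z)^dagger *)
Definition jump_symmetric (J J' : C -> 'M[C]_2) (z : C) :=
  forall k l : 'I_2, J z l k * dsig z k = dsig z l * cj (J' (cj z) k l).

Lemma jump_real_symmetric (g : R -> C) x t z : Im z = 0 ->
  jump_symmetric (jump_real g x t) (jump_real g x t) z.
Proof.
move=> z0; have zz : cj z = z by apply: eq_ReIm; rewrite ?ReJ// ImJ z0 oppr0.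
have E1 := cexp_phase_conj x t z; have E2 := conj_cexp_phase x t z.
rewrite zz in E1 E2.
move=> k l; rewrite zz; case: (ord2E k) => ->; case: (ord2E l) => ->;
  rewrite /jump_real /mx2 !mxE /dsig /= ?oppr0 ?conj_numE ?mulr1 ?mul1r//.
- by rewrite conjcM E2 mulrA.
- by rewrite 2!conjcM E1 conjK zz; ring.
- rewrite conjcD conjc1 conjcM zz mulrC; congr (_ * (_ + _ * _)).
  by rewrite conjX [`|_|]normr_normcE conjc_real.
Qed.

Lemma jump_disk_symmetric (f : {poly C}) a n x t z :
  jump_symmetric (jump_disk f a n x t) (jump_disk_hat f a n x t) z.
Proof.
move=> k l; case: (ord2E k) => ->; case: (ord2E l) => ->;
  rewrite /jump_disk /jump_disk_hat /mx2 !mxE /dsig /= ?oppr0 ?conj_numE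
    ?mulr1 ?mul1r ?mulr0 ?mul0r//.
rewrite 3!conjcM conjV conjX conjcB cexp_phase_conj !conjK; ring.
Qed.

Lemma jump_disk_hat_symmetric (f : {poly C}) a n x t z :
  jump_symmetric (jump_disk_hat f a n x t) (jump_disk f a n x t) z.
Proof.
move=> k l; case: (ord2E k) => ->; case: (ord2E l) => ->;
  rewrite /jump_disk /jump_disk_hat /mx2 !mxE /dsig /= ?oppr0 ?conj_numE
    ?mulr1 ?mul1r ?mulr0 ?mul0r//.
rewrite 2!conjcM conjV conjX conjcB conj_cexp_phase !conjK; ring.
Qed.

(* The entries of A diag(1, z) B^dagger. *)
Definition herm (z : C) (A B : 'M[C]_2) i j : C :=
  A i 0 * cj (B j 0) + z * A i 1 * cj (B j 1).

(** The symmetry lets the jump matrix pass from one factor to the other. With the jump relations at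
    [z] and at its conjugate, it gives equal values to the pairs ([Mp] at [z], [Mm] at the
    conjugate) and ([Mm] at [z], [Mp] at the conjugate). *)
Lemma herm_jump (J J' : C -> 'M[C]_2) z (A B : 'M[C]_2) i j :
  jump_symmetric J J' z ->
  herm z (A *m J z) B i j = herm z A (B *m J' (cj z)) i j.
Proof.
move=> h; rewrite /herm !mulmx2 !(conjcD, conjcM).
have h00 := h 0 0; have h01 := h 0 1; have h10 := h 1 0; have h11 := h 1 1.
rewrite /dsig /= !mulr1 ?mul1r in h00 h01 h10 h11.
have -> : A i 0 * (cj (B j 0) * cj (J' (cj z) 0 0) + cj (B j 1) * cj (J' (cj z) 1 0)) +
  z * A i 1 * (cj (B j 0) * cj (J' (cj z) 0 1) + cj (B j 1) * cj (J' (cj z) 1 1)) =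
  A i 0 * (cj (B j 0) * cj (J' (cj z) 0 0) + cj (B j 1) * cj (J' (cj z) 1 0)) +
  A i 1 * (cj (B j 0) * (z * cj (J' (cj z) 0 1)) + cj (B j 1) * (z * cj (J' (cj z) 1 1))).
  by ring.
by rewrite -h00 -h01 -h10 -h11; ring.
Qed.

(** On the real line the phase [E] has modulus 1, so for a row $(a,b)$ of [A] completing the square
    gives $|a+bz\overline{GE}|^2+z|b|^2$. For positive $z$ both terms vanish, hence $b=0$ and then
    $a=0$. *)
Lemma herm_jump_definite (g : R -> C) x t z (A : 'M[C]_2) : Im z = 0 -> 0 < Re z ->
  (forall i, herm z (A *m jump_real g x t z) A i i = 0) -> A = 0.
Proof.
move=> z0 rz h.
have zz : cj z = z by apply: eq_ReIm; rewrite ?ReJ// ImJ z0 oppr0.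
pose E := cexp (2 * 'i * Theta x t z).
have E1 : cexp (- (2 * 'i * Theta x t z)) = cj E.
  by have := conj_cexp_phase x t z; rewrite zz.
have E2 : E * cj E = 1 by rewrite -E1 -cexpD subrr cexp0.
pose G := g (Re z).
have sq w : w * cj w = (normc w ^+ 2)%:C.
  by rewrite rmorphXn; symmetry; exact: (sqr_normc w).
have GG : `|G| ^+ 2 = G * cj G by rewrite sqr_normc.
have key i : A i 0 = 0 /\ A i 1 = 0.
  set a := A i 0; set b := A i 1.
  have := h i; rewrite /herm !mulmx2 /jump_real /mx2 !mxE /= conj_numE.
  rewrite -/E E1 -/G GG -/a -/b => hE; clearbody E.
  have : (a + b * z * cj (G * E)) * cj (a + b * z * cj (G * E)) + z * (b * cj b) = 0.
    rewrite -[RHS]hE !(conjcD, conjcM) !conjK zz.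
    have -> : (a + b * z * (cj G * cj E)) * (cj a + cj b * z * (G * E)) + z * (b * cj b) =
      a * cj a + a * cj b * z * G * E + b * z * cj G * cj E * cj a +
      b * cj b * z * z * (G * cj G) * (E * cj E) + z * (b * cj b) by ring.
    by rewrite E2; ring.
  rewrite !sq (_ : z = (Re z)%:C); last by apply: eq_ReIm.
  rewrite -rmorphM -rmorphD => -[] /= /eqP.
  have p2 : 0 <= Re z * normc b ^+ 2 by apply: mulr_ge0; [exact: ltW|exact: sqr_ge0].
  rewrite (paddr_eq0 (sqr_ge0 _) p2) => /andP[].
  rewrite sqrf_eq0 normc_eq0 => /eqP h1.
  rewrite mulf_eq0 sqrf_eq0 normc_eq0 gt_eqF//= => /eqP b0.
  by split => //; move: h1; rewrite b0 !mul0r addr0.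
apply/matrixP => i j; rewrite mxE; have [h0 h1] := key i.
by case: (ord2E j) => ->.
Qed.

End Jumps.

(** * Vanishing of the solution *)

Section RiemannHilbert.
Variable R : realType.
Notation C := R[i].
Notation Re := (@complex.Re R).
Notation Im := (@complex.Im R).
Notation cj := (@conjc R).
Variables (g : R -> C) (N : nat) (lam : 'I_N -> C) (m : 'I_N -> nat)
  (f : {poly C}) (rho : 'I_N -> R) (x t : R) (M Mp Mm : C -> 'M[C]_2).
Hypothesis Hrho : admissible_radii lam rho.
Hypothesis HM : RH_problem g lam m f rho x t M Mp Mm.
Notation Sg := (contour lam rho).
Implicit Types (z w : C).

(** * Geometry of the contour and of its pieces *)

Lemma circleE (c z : C) (r : R) : circle c r z <-> normc (z - c) = r.
Proof. by rewrite /circle /= normr_normcE; split => [[->]//|->]. Qed.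

Lemma open_diskE (c z : C) (r : R) : open_disk c r z <-> normc (z - c) < r.
Proof. by rewrite /open_disk /= normr_normcE ltcR. Qed.

Lemma closed_diskE (c z : C) (r : R) : closed_disk c r z <-> normc (z - c) <= r.
Proof. by rewrite /closed_disk /= normr_normcE lecR. Qed.

Lemma circle_conj (c z : C) (r : R) : circle (cj c) r z <-> circle c r (cj z).
Proof. by rewrite !circleE -normc_conj conjcB conjK. Qed.

Lemma rho_gt0 k : 0 < rho k. Proof. by case: Hrho. Qed.

Lemma circle_upper k z : circle (lam k) (rho k) z -> 0 < Im z.
Proof.
case: Hrho => _ h _ hz; apply: (h k); apply/closed_diskE.
by move/circleE: hz => ->.
Qed.

Lemma circle_lower k z : circle (cj (lam k)) (rho k) z -> Im z < 0.
Proof. by move=> /circle_conj/circle_upper; rewrite ImJ oppr_gt0. Qed.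

Lemma circle_inj j k z : circle (lam j) (rho j) z -> circle (lam k) (rho k) z -> j = k.
Proof.
move=> hj hk; case: Hrho => _ _ h; apply: contrapT => jk.
have : (closed_disk (lam j) (rho j) `&` closed_disk (lam k) (rho k)) z.
  by split; apply/closed_diskE; [move/circleE: hj|move/circleE: hk] => ->.
by rewrite h.
Qed.

Lemma contourP z : Sg z <-> [\/ Im z = 0, exists k, circle (lam k) (rho k) z |
  exists k, circle (cj (lam k)) (rho k) z].
Proof.
split=> [[h|[k _ [h|h]]]|[h|[k h]|[k h]]].
- by apply: Or31.
- by apply: Or32; exists k.
- by apply: Or33; exists k.
- by left.
- by right; exists k => //; left.
- by right; exists k => //; right.
Qed.

Lemma contour_conj z : Sg z -> Sg (cj z).
Proof.
move=> /contourP[h|[k h]|[k h]]; apply/contourP.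
- by apply: Or31; rewrite ImJ h oppr0.
- by apply: Or33; exists k; apply/circle_conj; rewrite conjK.
- by apply: Or32; exists k; apply/circle_conj.
Qed.

Lemma near_off_circle (c z : C) (r : R) : ~ circle c r z ->
  \forall w \near nbhs z, ~ circle c r w.
Proof.
rewrite circleE => /eqP h; apply/nbhsCP; exists `|normc (z - c) - r|.
  by rewrite normr_gt0 subr_eq0.
move=> w hw; rewrite circleE => E; move: hw; rewrite -E; apply/negP; rewrite -leNgt.
have h1 := normc_sub_ge (z - c) (w - c); have h2 := normc_sub_ge (w - c) (z - c).
have e1 : (z - c) - (w - c) = - (w - z) by ring.
have e2 : (w - c) - (z - c) = w - z by ring.
by rewrite e1 normcN in h1; rewrite e2 in h2; rewrite ler_norml; lra.
Qed.

Lemma near_off_line z : Im z != 0 -> \forall w \near nbhs z, Im w != 0.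
Proof.
move=> h; apply/nbhsCP; exists `|Im z|; first by rewrite normr_gt0.
move=> w hw; apply: contraTneq hw => E; rewrite -leNgt -normcN.
by have := normc_Im (- (w - z)); rewrite ImN ImD ImN E add0r opprK.
Qed.

(** The local picture at a point of the contour: [D] is the only piece nearby, [L] and [S] are its
    left and right sides. It treats the line and both families of circles alike. *)
Record component (D L S : set C) (J : C -> 'M[C]_2) (z0 : C) : Prop := Component {
  comp_cover : forall w, [\/ L w, S w | D w];
  comp_near : \forall w \near nbhs z0, Sg w -> D w;
  comp_left : forall w, L w -> ~ D w;
  comp_right : forall w, S w -> ~ D w;
  comp_lim_left : M w @[w --> within L (nbhs z0)] --> Mp z0;
  comp_lim_right : M w @[w --> within S (nbhs z0)] --> Mm z0;
  comp_jump : Mp z0 = Mm z0 *m J z0 }.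

Lemma component_real z : Im z = 0 ->
  component (@realline R) (@upper R) (@lower R) (jump_real g x t) z.
Proof.
move=> z0; have [h1 h2 h3] := rh_real HM z0.
split => //.
- by move=> w; have [|h|] := ltgtP (Im w) 0; [apply: Or32|apply: Or31|apply: Or33].
- near=> w.
  have H : forall k, ~ circle (lam k) (rho k) w /\ ~ circle (cj (lam k)) (rho k) w.
    near: w; apply: filter_forall => k.
    have a1 : ~ circle (lam k) (rho k) z by move=> /circle_upper; rewrite z0 ltxx.
    have a2 : ~ circle (cj (lam k)) (rho k) z by move=> /circle_lower; rewrite z0 ltxx.
    have := near_off_circle a2; have := near_off_circle a1; apply: filterS2.
    by [].
  by move=> /contourP[//|[k hk]|[k hk]]; have [] := H k.
- by move=> w /= h1' h2'; move: h1'; rewrite /upper /= h2' ltxx.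
- by move=> w /= h1' h2'; move: h1'; rewrite /lower /= h2' ltxx.
Unshelve. all: by end_near. Qed.

Lemma component_upper k z : circle (lam k) (rho k) z ->
  component (circle (lam k) (rho k)) (~` closed_disk (lam k) (rho k))
    (open_disk (lam k) (rho k)) (jump_disk f (lam k) (m k) x t) z.
Proof.
move=> hz; have [h1 h2 h3] := rh_disk HM hz.
split => //.
- move=> w; have [h|h|h] := ltgtP (normc (w - lam k)) (rho k).
  + by apply: Or32; apply/open_diskE.
  + by apply: Or31; rewrite /setC /= => /closed_diskE; rewrite leNgt h.
  + by apply: Or33; apply/circleE.
- near=> w.
  have H : forall j, (j <> k -> ~ circle (lam j) (rho j) w) /\ ~ circle (cj (lam j)) (rho j) w.
    near: w; apply: filter_forall => j.
    have a2 : ~ circle (cj (lam j)) (rho j) z.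
      by move=> /circle_lower; have := circle_upper hz; case: ltgtP.
    have [jk|/eqP jk] := eqVneq j k.
      by apply: filterS (near_off_circle a2) => v hv; split => // /(_ jk).
    have a1 : ~ circle (lam j) (rho j) z by move=> h; apply: jk; exact: circle_inj h hz.
    have := near_off_circle a2; have := near_off_circle a1; apply: filterS2.
    by [].
  have Hi : Im w != 0.
    by near: w; apply: near_off_line; rewrite gt_eqF// (circle_upper hz).
  move=> /contourP[h|[j hj]|[j hj]].
  + by rewrite h eqxx in Hi.
  + have [jk|/eqP jk] := eqVneq j k; first by rewrite -jk.
    by have [h _] := H j; case: (h jk).
  + by have [_] := H j.
- move=> w /= h /circleE E; apply: h; apply/closed_diskE; by rewrite E.
- by move=> w /open_diskE h /circleE E; move: h; rewrite E ltxx.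
Unshelve. all: by end_near. Qed.

Lemma component_lower k z : circle (cj (lam k)) (rho k) z ->
  component (circle (cj (lam k)) (rho k)) (open_disk (cj (lam k)) (rho k))
    (~` closed_disk (cj (lam k)) (rho k)) (jump_disk_hat f (lam k) (m k) x t) z.
Proof.
move=> hz; have [h1 h2 h3] := rh_disk_hat HM hz.
split => //.
- move=> w; have [h|h|h] := ltgtP (normc (w - cj (lam k))) (rho k).
  + by apply: Or31; apply/open_diskE.
  + by apply: Or32; rewrite /setC /= => /closed_diskE; rewrite leNgt h.
  + by apply: Or33; apply/circleE.
- near=> w.
  have H : forall j, (j <> k -> ~ circle (cj (lam j)) (rho j) w) /\ ~ circle (lam j) (rho j) w.
    near: w; apply: filter_forall => j.
    have a2 : ~ circle (lam j) (rho j) z.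
      by move=> /circle_upper; have := circle_lower hz; case: ltgtP.
    have [jk|/eqP jk] := eqVneq j k.
      by apply: filterS (near_off_circle a2) => v hv; split => // /(_ jk).
    have a1 : ~ circle (cj (lam j)) (rho j) z.
      by move=> /circle_conj h; apply: jk; apply: circle_inj h _; exact/circle_conj.
    have := near_off_circle a2; have := near_off_circle a1; apply: filterS2.
    by [].
  have Hi : Im w != 0.
    by near: w; apply: near_off_line; rewrite lt_eqF// (circle_lower hz).
  move=> /contourP[h|[j hj]|[j hj]].
  + by rewrite h eqxx in Hi.
  + by have [_] := H j.
  + have [jk|/eqP jk] := eqVneq j k; first by rewrite -jk.
    by have [h _] := H j; case: (h jk).
- by move=> w /open_diskE h /circleE E; move: h; rewrite E ltxx.
- move=> w /= h /circleE E; apply: h; apply/closed_diskE; by rewrite E.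
Unshelve. all: by end_near. Qed.

Lemma near_off_contour z : ~ Sg z -> \forall w \near nbhs z, ~ Sg w.
Proof.
move=> hz; near=> w.
have H : forall j, ~ circle (lam j) (rho j) w /\ ~ circle (cj (lam j)) (rho j) w.
  near: w; apply: filter_forall => j.
  have a1 : ~ circle (lam j) (rho j) z.
    by move=> h; apply: hz; apply/contourP; apply: Or32; exists j.
  have a2 : ~ circle (cj (lam j)) (rho j) z.
    by move=> h; apply: hz; apply/contourP; apply: Or33; exists j.
  have := near_off_circle a2; have := near_off_circle a1; apply: filterS2.
  by [].
have Hi : Im w != 0.
  near: w; apply: near_off_line; apply/eqP => h; apply: hz.
  by apply/contourP; apply: Or31.
move=> /contourP[h|[j hj]|[j hj]].
- by rewrite h eqxx in Hi.
- by have [] := H j.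
- by have [] := H j.
Unshelve. all: by end_near. Qed.

(** Near each of its points the contour coincides with a single line or circle, since the pieces do
    not touch. *)
Lemma holo_off_curve_off_contour (F : C -> C) z :
  (\forall w \near nbhs z, {for w, continuous F} /\ (~ Sg w -> exists l, HasD F w l)) ->
  holo_off_curve F z.
Proof.
have mk (P Q : C -> Prop) : (\forall w \near nbhs z, P w) -> (\forall w \near nbhs z, Q w) ->
    exists2 d : R, 0 < d & forall w, normc (w - z) < d -> P w /\ Q w.
  move=> /nbhsCP[d1 d10 H1] /nbhsCP[d2 d20 H2].
  exists (Num.min d1 d2); first by rewrite lt_min d10.
  by move=> w; rewrite lt_min => /andP[/H1 ? /H2].
move=> hF; have [hz|hz] := pselect (Sg z); last first.
  have [d d0 H] := mk _ _ hF (near_off_contour hz).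
  by apply: holo_off_curve_holo d0 _ => w /H[[_ h] /h].
have circ c r D L S J : circle c r z -> 0 < r -> D = circle c r -> component D L S J z ->
    holo_off_curve F z.
  move=> hc r0 -> /comp_near hn; have [d d0 H] := mk _ _ hF hn.
  exists d => //; split; first by move=> w /H[[]].
  right; exists c.
    by apply: contraTneq r0 => zc; move/circleE: hc => <-; rewrite zc subrr normc0 ltxx.
  move=> w /H[[_ h] h2] wc; apply: h => /h2 /circleE E.
  by move/circleE: hc => E2; rewrite E E2 eqxx in wc.
move/contourP: hz => [hz|[k hz]|[k hz]].
- have [d d0 H] := mk _ _ hF (comp_near (component_real hz)).
  exists d => //; split; first by move=> w /H[[]].
  left; exists 0 => w /H[[_ h] h2] wc; apply: h => /h2 E.
  by rewrite (E : Im w = 0) eqxx in wc.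
- exact: circ hz (rho_gt0 k) erefl (component_upper hz).
- exact: circ hz (rho_gt0 k) erefl (component_lower hz).
Qed.

Definition ext (X : C -> 'M[C]_2) z : 'M[C]_2 := if pselect (Sg z) then X z else M z.

Lemma ext_on X z : Sg z -> ext X z = X z.
Proof. by rewrite /ext; case: pselect. Qed.

Lemma ext_off X z : ~ Sg z -> ext X z = M z.
Proof. by rewrite /ext; case: pselect. Qed.

(** * Limits at the contour from either side and along it *)

Lemma within_limP (F : C -> C) (A : set C) z (l : C) :
  F w @[w --> within A (nbhs z)] --> l <->
  forall e : R, 0 < e -> exists2 d : R, 0 < d &
    forall w, normc (w - z) < d -> A w -> normc (F w - l) < e.
Proof.
split.
- move=> h e e0.
  have : nbhs l [set v | normc (v - l) < e] by apply/nbhsCP; exists e.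
  by move=> /h; rewrite /= /within /= => /nbhsCP.
- move=> h P /nbhsCP[e e0 H]; have [d d0 K] := h e e0.
  apply/nbhsCP; exists d => // w hw Aw; apply: H; exact: K.
Qed.

Lemma lim_entry (F : C -> 'M[C]_2) (A : set C) z (l : 'M[C]_2) i j :
  F w @[w --> within A (nbhs z)] --> l ->
  F w i j @[w --> within A (nbhs z)] --> l i j.
Proof.
move=> h P hP; apply: (h (fun A : 'M[C]_2 => P (A i j))).
exact: (@coord_continuous _ _ _ i j l P hP).
Qed.

Lemma ext_lim_off X D L S J z0 (A : set C) (l : 'M[C]_2) i j : component D L S J z0 ->
  (forall w, A w -> ~ D w) -> M w @[w --> within A (nbhs z0)] --> l ->
  ext X w i j @[w --> within A (nbhs z0)] --> l i j.
Proof.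
move=> /comp_near/nbhsCP[d d0 H] AD /lim_entry/within_limP h.
apply/within_limP => e e0; have [d' d'0 K] := h i j e e0.
exists (Num.min d d'); first by rewrite lt_min d0.
move=> w; rewrite lt_min => /andP[w1 w2] Aw.
by rewrite ext_off; [exact: K|move=> /(H _ w1); exact: AD].
Qed.

Lemma ext_lim_on X (D : set C) z0 i j : {within Sg, continuous X} ->
  (forall w, D w -> Sg w) -> D z0 ->
  ext X w i j @[w --> within D (nbhs z0)] --> X z0 i j.
Proof.
move=> /subspace_continuousP cX DS Dz.
have /lim_entry/within_limP h := cX _ (DS _ Dz).
apply/within_limP => e e0; have [d d0 K] := h i j e e0.
by exists d => // w w1 /DS Dw; rewrite ext_on//; exact: K.
Qed.

(** Left side, right side and curve cover the plane, so three restricted limits decide continuity.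
    The limit along the curve is where continuity of the boundary values enters. *)
Lemma comp_continuous (F : C -> C) D L S J z0 : component D L S J z0 ->
  F w @[w --> within L (nbhs z0)] --> F z0 ->
  F w @[w --> within S (nbhs z0)] --> F z0 ->
  F w @[w --> within D (nbhs z0)] --> F z0 ->
  {for z0, continuous F}.
Proof.
move=> hc /within_limP h1 /within_limP h2 /within_limP h3; apply/contCP => e e0.
have [d1 d10 H1] := h1 e e0; have [d2 d20 H2] := h2 e e0; have [d3 d30 H3] := h3 e e0.
exists (Num.min d1 (Num.min d2 d3)); first by rewrite !lt_min d10 d20.
move=> w; rewrite !lt_min => /and3P[w1 w2 w3].
by have [?|?|?] := comp_cover hc w; [exact: H1|exact: H2|exact: H3].
Qed.

Lemma herm_lim (A B : C -> 'M[C]_2) (a b : 'M[C]_2) (U : set C) z0 i j :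
  (forall k l, A w k l @[w --> within U (nbhs z0)] --> a k l) ->
  (forall k l, B w k l @[w --> within U (nbhs z0)] --> b k l) ->
  herm w (A w) (B w) i j @[w --> within U (nbhs z0)] --> herm z0 a b i j.
Proof.
move=> hA hB.
have hC k l : cj (B w k l) @[w --> within U (nbhs z0)] --> cj (b k l).
  move=> P hP; apply: (hB k l (fun v => P (cj v))).
  exact: (@cont_conj R (b k l) P hP).
have hid : w @[w --> within U (nbhs z0)] --> z0 by exact: cvg_within.
exact: (cvgD (cvgM (hA i 0) (hC j 0)) (cvgM (cvgM hid (hA i 1)) (hC j 1))).
Qed.

Lemma conj_lim (F : C -> C) (A A' : set C) z0 (l : C) : (forall w, A w -> A' (cj w)) ->
  F w @[w --> within A' (nbhs (cj z0))] --> l ->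
  F (cj w) @[w --> within A (nbhs z0)] --> l.
Proof.
move=> AA /within_limP h; apply/within_limP => e e0; have [d d0 K] := h e e0.
exists d => // w hw Aw; apply: K; last exact: AA.
by rewrite -conjcB normc_conj.
Qed.

(* On the contour the two factors take boundary values from opposite sides, since
   conjugation exchanges the sides. *)
Definition hermM i j z : C := herm z (ext Mp z) (ext Mm (cj z)) i j.

Lemma hermM_continuous_comp D L S J D' L' S' J' z0 i j :
  component D L S J z0 -> component D' L' S' J' (cj z0) -> D z0 ->
  (forall w, D w -> Sg w) ->
  (forall w, L w -> S' (cj w)) -> (forall w, S w -> L' (cj w)) ->
  jump_symmetric J J' z0 -> {for z0, continuous (hermM i j)}.
Proof.
move=> hc hc' Dz DS LS SL sym; have [cMp cMm] := rh_continuous HM.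
have Sz := DS _ Dz; have Sz' := contour_conj Sz.
have HE : hermM i j z0 = herm z0 (Mp z0) (Mm (cj z0)) i j by rewrite /hermM !ext_on.
have key (U : set C) (a b : 'M[C]_2) :
    (forall k l, ext Mp w k l @[w --> within U (nbhs z0)] --> a k l) ->
    (forall k l, ext Mm (cj w) k l @[w --> within U (nbhs z0)] --> b k l) ->
    hermM i j w @[w --> within U (nbhs z0)] --> herm z0 a b i j.
  exact: (@herm_lim (ext Mp) (fun w => ext Mm (cj w)) a b U z0 i j).
have lL : hermM i j w @[w --> within L (nbhs z0)] --> hermM i j z0.
  rewrite HE; apply (key L (Mp z0) (Mm (cj z0))) => k l.
    exact (ext_lim_off Mp (i := k) (j := l) hc (comp_left hc) (comp_lim_left hc)).
  exact (@conj_lim (fun w => ext Mm w k l) L S' z0 _ LS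
    (ext_lim_off Mm (i := k) (j := l) hc' (comp_right hc') (comp_lim_right hc'))).
have lS : hermM i j w @[w --> within S (nbhs z0)] --> hermM i j z0.
  (* From the right, the limit involves [Mm] at [z0] and [Mp] at the conjugate point; symmetry of
     the jumps identifies it with the value at [z0]. *)
  rewrite HE (comp_jump hc) (herm_jump _ _ _ _ sym) -(comp_jump hc').
  apply (key S (Mm z0) (Mp (cj z0))) => k l.
    exact (ext_lim_off Mp (i := k) (j := l) hc (comp_right hc) (comp_lim_right hc)).
  exact (@conj_lim (fun w => ext Mm w k l) S L' z0 _ SL
    (ext_lim_off Mm (i := k) (j := l) hc' (comp_left hc') (comp_lim_left hc'))).
have lD : hermM i j w @[w --> within D (nbhs z0)] --> hermM i j z0.
  rewrite HE; apply (key D (Mp z0) (Mm (cj z0))) => k l.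
    exact (ext_lim_on (i := k) (j := l) cMp DS Dz).
  exact (@conj_lim (fun w => ext Mm w k l) D Sg z0 _ (fun w hw => contour_conj (DS w hw))
    (ext_lim_on (i := k) (j := l) cMm (fun _ => id) Sz')).
exact: (comp_continuous hc lL lS lD).
Qed.

Lemma closed_disk_conj (c z : C) (r : R) : closed_disk (cj c) r (cj z) <-> closed_disk c r z.
Proof. by rewrite !closed_diskE -conjcB normc_conj. Qed.

Lemma open_disk_conj (c z : C) (r : R) : open_disk (cj c) r (cj z) <-> open_disk c r z.
Proof. by rewrite !open_diskE -conjcB normc_conj. Qed.

Lemma derivable_entry (F : C -> 'M[C]_2) z i j : derivable F z 1 ->
  exists l, HasD (fun w => F w i j) z l.
Proof.
move=> /cvg_ex[l hl]; apply: derivable_HasD; apply/cvg_ex; exists (l i j) => P hP.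
have E : (fun h : C => h^-1 *: (F (h *: 1 + z) i j - F z i j)) =
    (fun h : C => (h^-1 *: (F (h *: 1 + z) - F z)) i j).
  by apply/funext => h; rewrite !mxE.
rewrite E; apply (hl (fun A : 'M[C]_2 => P (A i j))).
exact: (@coord_continuous _ _ _ i j l P hP).
Qed.

Lemma ext_HasD X i j z : ~ Sg z -> exists l, HasD (fun w => ext X w i j) z l.
Proof.
move=> hz; have [l hl] := derivable_entry i j (rh_analytic HM hz).
exists l; have /nbhsCP[d d0 K] := near_off_contour hz.
by apply: HasD_near d0 _ hl => w /K wS; rewrite ext_off.
Qed.

Lemma hermM_HasD i j z : ~ Sg z -> exists l, HasD (hermM i j) z l.
Proof.
move=> hz; have hz' : ~ Sg (cj z) by move=> /contour_conj; rewrite conjK.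
have [l1 h1] := ext_HasD Mp i 0 hz; have [l2 h2] := ext_HasD Mp i 1 hz.
have [l3 h3] := ext_HasD Mm j 0 hz'; have [l4 h4] := ext_HasD Mm j 1 hz'.
eexists; exact: (HasD_D (HasD_M h1 (HasD_conj h3))
                        (HasD_M (HasD_M (HasD_id z) h2) (HasD_conj h4))).
Qed.

Lemma hermM_continuous i j z : {for z, continuous (hermM i j)}.
Proof.
have [|hz] := pselect (Sg z); last by have [l /HasD_cont] := hermM_HasD i j hz.
move=> /contourP[hz|[k hz]|[k hz]].
- have hz' : Im (cj z) = 0 by rewrite ImJ hz oppr0.
  refine (@hermM_continuous_comp _ _ _ _ _ _ _ _ z i j (component_real hz) (component_real hz') hz _ _ _ _).
  + by move=> w hw; apply/contourP; apply: Or31.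
  + by move=> w; rewrite /upper /lower /= ImJ oppr_lt0.
  + by move=> w; rewrite /upper /lower /= ImJ oppr_gt0.
  + exact: jump_real_symmetric.
- have hz' : circle (cj (lam k)) (rho k) (cj z) by apply/circle_conj; rewrite conjK.
  refine (@hermM_continuous_comp _ _ _ _ _ _ _ _ z i j (component_upper hz) (component_lower hz') hz _ _ _ _).
  + by move=> w hw; apply/contourP; apply: Or32; exists k.
  + by move=> w /= hw /closed_disk_conj.
  + by move=> w /= hw; apply/open_disk_conj.
  + exact: jump_disk_symmetric.
- have hz' : circle (lam k) (rho k) (cj z) by apply/circle_conj.
  refine (@hermM_continuous_comp _ _ _ _ _ _ _ _ z i j (component_lower hz) (component_upper hz') hz _ _ _ _).
  + by move=> w hw; apply/contourP; apply: Or33; exists k.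
  + by move=> w /= hw; apply/open_disk_conj; rewrite conjK.
  + by move=> w /= hw h; apply: hw; rewrite -(conjK w); apply/closed_disk_conj.
  + exact: jump_disk_hat_symmetric.
Qed.

Lemma hermM_good i j z : holo_off_curve (hermM i j) z.
Proof.
apply: holo_off_curve_off_contour; near=> w; split; first exact: hermM_continuous.
exact: hermM_HasD.
Unshelve. all: by end_near. Qed.

(** Far out the contour is the real line alone; the sum serves as a common bound for all circles. *)
Lemma circles_bounded z : Sg z -> Im z != 0 ->
  normc z <= \sum_k (normc (lam k) + rho k).
Proof.
have key k w : normc (w - lam k) = rho k -> normc w <= \sum_k (normc (lam k) + rho k).
  move=> h; have := normc_triangle (w - lam k) (lam k); rewrite subrK h => h1.
  apply: le_trans h1 _; rewrite (bigD1 k)//= (addrC (rho k)) lerDl sumr_ge0// => j _.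
  by rewrite addr_ge0 ?normc_ge0// ltW// rho_gt0.
move=> /contourP[->|[k hk]|[k hk]]; first by rewrite eqxx.
  by move=> _; apply: (key k); exact/circleE.
by move=> _; rewrite -normc_conj; apply: (key k); apply/circleE/circle_conj.
Qed.

(** The weight [z] costs one power against the two factors of order $1/|z|$. The decay hypothesis
    holds off the contour only, so distant real points are reached by continuity. *)
Lemma hermM_decay i j (e : R) : 0 < e -> exists r : R, forall z, r <= normc z ->
  normc (hermM i j z) <= e.
Proof.
move=> e0; have [K [r hK]] := rh_decay HM.
have bM z k l : ~ Sg z -> r <= normc z -> 1 <= normc z -> normc (M z k l) <= K / normc z.
  move=> hz rz z1; have := hK z hz; rewrite normr_normcE lecR => /(_ rz k l).
  by rewrite normr_normcE -fmorphV -rmorphM lecR.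
(* Beyond this modulus the decay bound holds, $1/n\le 1$, $K^2/n\le e/4$, and no circle is met. *)
pose n0 := `|r| + 1 + 4 * K ^+ 2 / e + \sum_k (normc (lam k) + rho k).
have B0 : 0 <= \sum_k (normc (lam k) + rho k).
  by rewrite sumr_ge0// => k _; rewrite addr_ge0 ?normc_ge0// ltW// rho_gt0.
have K0 : 0 <= 4 * K ^+ 2 / e.
  by apply: divr_ge0; [apply: mulr_ge0; [lra|exact: sqr_ge0]|exact: ltW].
have rr := ler_norm r; have r0 := normr_ge0 r.
have off z : ~ Sg z -> n0 <= normc z -> normc (hermM i j z) <= e / 2.
  rewrite /n0 => hz nz; set n := normc z in nz *.
  have n1 : 1 <= n by lra. have n00 : 0 < n by lra.
  have rn : r <= n by lra.
  have hz' : ~ Sg (cj z) by move=> /contour_conj; rewrite conjK.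
  have nc : normc (cj z) = n by rewrite normc_conj.
  have a k : normc (ext Mp z i k) <= K / n by rewrite ext_off//; exact: bM.
  have b k : normc (cj (ext Mm (cj z) j k)) <= K / n.
    by rewrite normc_conj ext_off// -nc; apply: bM; rewrite ?nc.
  have ab k : normc (ext Mp z i k) * normc (cj (ext Mm (cj z) j k)) <= K / n * (K / n).
    by apply: ler_pM; rewrite ?normc_ge0.
  have p1 : K / n * (K / n) <= K ^+ 2 / n.
    rewrite (_ : K / n * (K / n) = K ^+ 2 / n * n^-1).
      rewrite ler_piMr ?invf_le1// divr_ge0 ?sqr_ge0// ltW//.
    by field; exact: lt0r_neq0.
  have p2 : n * (K / n * (K / n)) = K ^+ 2 / n by field; exact: lt0r_neq0.
  have p3 : K ^+ 2 / n <= e / 4.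
    rewrite ler_pdivrMr// mulrC -ler_pdivrMr ?divr_gt0//.
    by rewrite (_ : K ^+ 2 / (e / 4) = 4 * K ^+ 2 / e); [lra|field; exact: lt0r_neq0].
  rewrite /hermM /herm; apply: le_trans (normc_triangle _ _) _.
  rewrite (normcM (ext Mp z i 0)) -mulrA (normcM z) (normcM (ext Mp z i 1)) -/n.
  have := ab 0; have : n * (normc (ext Mp z i 1) * normc (cj (ext Mm (cj z) j 1)))
      <= n * (K / n * (K / n)) by rewrite ler_wpM2l ?ab// ltW.
  rewrite p2; lra.
exists (n0 + 1) => z hz; have [Sz|Sz] := pselect (Sg z); last first.
  by have := off z Sz; lra.
have z0 : Im z = 0.
  by apply/eqP; apply: contraLR isT => /(circles_bounded Sz); move: hz; rewrite /n0; lra.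
have e2 : 0 < e / 2 by rewrite divr_gt0.
have /contCP/(_ _ e2)[d d0 Hd] := @hermM_continuous i j z.
have /nbhsCP[d' d'0 Hd'] := comp_near (component_real z0).
pose del := Num.min d d' / 2.
have m0 : 0 < Num.min d d' by rewrite lt_min d0.
have del0 : 0 < del by rewrite divr_gt0.
have [deld deld'] : del < d /\ del < d'.
  have : Num.min d d' <= d by rewrite ge_min lexx.
  have : Num.min d d' <= d' by rewrite ge_min lexx orbT.
  by rewrite /del; split; lra.
(* A vertical shift of a real point leaves the contour and does not decrease the modulus. *)
pose w := z + (0 +i* del).
have wz : normc (w - z) = del.
  by rewrite /w addrAC subrr add0r /= expr0n add0r sqrtr_sqr gtr0_norm.
have Sw : ~ Sg w.
  move=> /Hd'; rewrite wz => /(_ deld'); rewrite /realline /= /w ImD /= z0 add0r => E.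
  by rewrite E ltxx in del0.
have nw : n0 <= normc w.
  have : normc z <= normc w.
    by apply: normc_le; rewrite /w ?ReD ?ImD /= ?addr0// z0 normr0.
  lra.
have := off w Sw nw; have := Hd w; rewrite wz => /(_ deld).
have := normc_triangle (hermM i j z - hermM i j w) (hermM i j w); rewrite subrK normc_distC; lra.
Qed.

Lemma hermM_eq0 i j z : hermM i j z = 0.
Proof. exact: holo_off_curve_decay_eq0 (hermM_good i j) (hermM_decay i j) z. Qed.

(** * From the vanishing form to the vanishing of the solution *)

Lemma boundary_eq0 (s : R) : 0 < s -> Mp s%:C = 0 /\ Mm s%:C = 0.
Proof.
move=> s0; have z0 : Im s%:C = 0 by [].
have hc := component_real z0.
have Sz : Sg s%:C by apply/contourP; apply: Or31.
have Mm0 : Mm s%:C = 0.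
  apply: (herm_jump_definite (g := g) (x := x) (t := t) z0) => //= i.
  have := hermM_eq0 i i s%:C; rewrite /hermM conjc_real !ext_on//.
  by rewrite (comp_jump hc).
by split => //; rewrite (comp_jump hc) Mm0 mul0mx.
Qed.

Lemma ext_continuous_comp D L S J z0 i j : component D L S J z0 -> D z0 ->
  (forall w, D w -> Sg w) -> Mp z0 i j = Mm z0 i j ->
  {for z0, continuous (fun z => ext Mp z i j)}.
Proof.
move=> hc Dz DS E; have [cMp _] := rh_continuous HM.
have E0 : ext Mp z0 i j = Mp z0 i j by rewrite ext_on//; exact: DS.
have lL : ext Mp w i j @[w --> within L (nbhs z0)] --> ext Mp z0 i j.
  rewrite E0; exact (ext_lim_off Mp (i := i) (j := j) hc (comp_left hc) (comp_lim_left hc)).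
have lS : ext Mp w i j @[w --> within S (nbhs z0)] --> ext Mp z0 i j.
  rewrite E0 E; exact (ext_lim_off Mp (i := i) (j := j) hc (comp_right hc) (comp_lim_right hc)).
have lD : ext Mp w i j @[w --> within D (nbhs z0)] --> ext Mp z0 i j.
  rewrite E0; exact (ext_lim_on (i := i) (j := j) cMp DS Dz).
exact: (comp_continuous (F := fun z => ext Mp z i j) hc lL lS lD).
Qed.

(** In an open half-plane the contour consists of circles; an entry without jump there is continuous
    across them, hence regular enough for [half_plane_eq0]. The limits on the positive half-line
    come from [Mp] for [s = 1] and from [Mm] for [s = -1]. *)
Lemma half_plane_entry_eq0 (s : R) i j : s ^+ 2 = 1 ->
  (forall z, 0 < s * Im z -> Sg z -> Mp z i j = Mm z i j) ->
  forall z, 0 < s * Im z -> ext Mp z i j = 0.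
Proof.
move=> s2 hj; apply: (half_plane_eq0 s2 (f := fun z => ext Mp z i j)).
- move=> z sz.
  have iz : 0 < `|Im z|.
    by rewrite normr_gt0; apply: contraTneq sz => ->; rewrite mulr0 ltxx.
  apply: holo_off_curve_off_contour; apply/nbhsCP; exists `|Im z| => // w hw.
  have sw := half_plane_open s2 hw sz; split; last exact: ext_HasD.
  have [Sw|Sw] := pselect (Sg w); last first.
    by have [l /HasD_cont] := ext_HasD Mp i j Sw.
  have E := hj w sw Sw; move/contourP: Sw => [h|[k h]|[k h]].
  + by rewrite h mulr0 ltxx in sw.
  + apply: (ext_continuous_comp (component_upper h) h _ E) => v hv.
    by apply/contourP; apply: Or32; exists k.
  + apply: (ext_continuous_comp (component_lower h) h _ E) => v hv.
    by apply/contourP; apply: Or33; exists k.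
- move=> y y0; have z0 : Im y%:C = 0 by [].
  have /nbhsCP[d d0 h] := comp_near (component_real z0).
  exists d => // w /h wS sw; apply: ext_HasD => /wS E.
  by rewrite (E : Im w = 0) mulr0 ltxx in sw.
- move=> y y0 e e0; have z0 : Im y%:C = 0 by [].
  have hc := component_real z0; have [Mp0 Mm0] := boundary_eq0 y0.
  have /eqP := s2; rewrite sqrf_eq1 => /orP[/eqP ->|/eqP ->].
  + have /within_limP/(_ e e0)[d d0 h] :=
      ext_lim_off Mp (i := i) (j := j) hc (comp_left hc) (comp_lim_left hc).
    exists d => // w hw; rewrite mul1r => /(h w hw).
    by rewrite Mp0 mxE subr0.
  + have /within_limP/(_ e e0)[d d0 h] :=
      ext_lim_off Mp (i := i) (j := j) hc (comp_right hc) (comp_lim_right hc).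
    exists d => // w hw; rewrite mulN1r oppr_gt0 => /(h w hw).
    by rewrite Mm0 mxE subr0.
Qed.

Theorem RH_vanishing z : ~ Sg z -> M z = 0.
Proof.
move=> hz; have iz : Im z != 0.
  by apply/eqP => h; apply: hz; apply/contourP; apply: Or31.
suff H i : ext Mp z i 0 = 0 /\ ext Mp z i 1 = 0.
  apply/matrixP => i j; rewrite mxE -(ext_off Mp hz); have [h0 h1] := H i.
  by case: (ord2E j) => ->.
have [neg|pos|E] := ltgtP (Im z) 0; last by rewrite E eqxx in iz.
- have s2 : (-1 : R) ^+ 2 = 1 by rewrite sqrrN expr1n.
  have circ w : 0 < -1 * Im w -> Sg w -> exists k, circle (cj (lam k)) (rho k) w.
    rewrite mulN1r oppr_gt0 => iw /contourP[h|[k /circle_upper h]|//].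
      by rewrite h ltxx in iw.
    by have := lt_trans iw h; rewrite ltxx.
  (* The jumps here are lower triangular with unit diagonal: the second column is unchanged, and the
     first gains a multiple of the second, which is 0 on the circles by the time it is needed. *)
  have c1 w : 0 < -1 * Im w -> ext Mp w i 1 = 0.
    apply: half_plane_entry_eq0 => // v sv /(circ v sv)[k /component_lower hc].
    by rewrite (comp_jump hc) mulmx2 !mxE /= mulr0 add0r mulr1.
  have c0 w : 0 < -1 * Im w -> ext Mp w i 0 = 0.
    apply: half_plane_entry_eq0 => // v sv Sv; have [k hk] := circ v sv Sv.
    have hc := component_lower hk.
    have E1 : Mp v i 1 = Mm v i 1.
      by rewrite (comp_jump hc) mulmx2 !mxE /= mulr0 add0r mulr1.
    have := c1 v sv; rewrite ext_on// E1 => E2.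
    by rewrite (comp_jump hc) mulmx2 !mxE /= E2 mul0r addr0 mulr1.
  by split; [apply: c0|apply: c1]; rewrite mulN1r oppr_gt0.
- have s2 : (1 : R) ^+ 2 = 1 by rewrite expr1n.
  have circ w : 0 < 1 * Im w -> Sg w -> exists k, circle (lam k) (rho k) w.
    rewrite mul1r => iw /contourP[h|//|[k /circle_lower h]].
      by rewrite h ltxx in iw.
    by have := lt_trans iw h; rewrite ltxx.
  (* The jumps are now upper triangular, and the two columns exchange their roles. *)
  have c0 w : 0 < 1 * Im w -> ext Mp w i 0 = 0.
    apply: half_plane_entry_eq0 => // v sv /(circ v sv)[k /component_upper hc].
    by rewrite (comp_jump hc) mulmx2 !mxE /= mulr0 addr0 mulr1.
  have c1 w : 0 < 1 * Im w -> ext Mp w i 1 = 0.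
    apply: half_plane_entry_eq0 => // v sv Sv; have [k hk] := circ v sv Sv.
    have hc := component_upper hk.
    have E1 : Mp v i 0 = Mm v i 0.
      by rewrite (comp_jump hc) mulmx2 !mxE /= mulr0 addr0 mulr1.
    have := c0 v sv; rewrite ext_on// E1 => E2.
    by rewrite (comp_jump hc) mulmx2 !mxE /= E2 mul0r add0r mulr1.
  by split; [apply: c0|apply: c1]; rewrite mul1r.
Qed.

End RiemannHilbert.

Unset Implicit Arguments.
Set Strict Implicit.

Theorem lemma3p3 (R : realType)
    (u v : R -> R -> R[i]) (Huv : mtm_solution u v)
    (Phip1 Phip2 Phim1 Phim2 : R -> R -> R[i] -> 'cV[R[i]]_2)
    (HPhi : jost_functions u v Phip1 Phip2 Phim1 Phim2)
    (alpha : R[i] -> R[i]) (beta : R -> R[i])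
    (Hscat : scattering_data Phip1 Phip2 Phim1 Phim2 alpha beta)
    (N : nat) (lam : 'I_N -> R[i]) (m : 'I_N -> nat) (f : {poly R[i]})
    (Hdisc : discrete_data Phip1 Phip2 Phim1 Phim2 alpha lam m f)
    (x t : R) (Ht : 0 <= t)
    (rho : 'I_N -> R) (Hrho : admissible_radii lam rho)
    (M Mp Mm : R[i] -> 'M[R[i]]_2)
    (HM : RH_problem (reflection alpha beta) lam m f rho x t M Mp Mm) :
  forall z, ~ contour lam rho z -> M z = 0.
Proof. exact: (RH_vanishing Hrho HM). Qed.
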